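(* Let $d\ge1$, $p>1$ and $s\in(0,1)$ with $sp<d$, let $p<q<\frac{p(d-s)}{d-sp}$, and set $r=p\frac{q-1}{p-1}$ and \[ a=\frac{d(q-p)}{(q-1)\big(dp-(d-sp)q\big)}, \] where $\delta:=dp-(d-sp)q>0$. Then there is an optimal (i.e. smallest) constant $\mathscr{L}\in(0,\infty)$ such that for every $u\in\mathcal{D}^{p,q}_s$, \[ \|u\|_{L^r(\mathbb{R}^d)}\le\mathscr{L}\,[u]_{W^{s,p}(\mathbb{R}^d)}^a\,\|u\|_{L^q(\mathbb{R}^d)}^{1-a}. \]
   Context: $[u]_{W^{s,p}(\mathbb{R}^d)}^p=\int_{\mathbb{R}^d}\int_{\mathbb{R}^d}\frac{|u(x)-u(y)|^p}{|x-y|^{d+sp}}dx\,dy$; $W^{s,p}(\mathbb{R}^d)$ is the completion of $C_c^\infty(\mathbb{R}^d)$ under $(\|u\|_{L^p}^p+[u]_{W^{s,p}}^p)^{1/p}$; and $\mathcal{D}^{p,q}_s=(W^{s,p}(\mathbb{R}^d)\cap L^q(\mathbb{R}^d))\setminus\{0\}$. *)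

(* Defs.v *)
From HB Require Import structures.
From mathcomp Require Import all_boot all_order all_algebra.
From mathcomp Require Import all_classical all_reals all_analysis.
Set Implicit Arguments. Unset Strict Implicit. Unset Printing Implicit Defensive.
Import Order.TTheory GRing.Theory Num.Theory.
Import numFieldNormedType.Exports.
Local Open Scope classical_set_scope.
Local Open Scope ring_scope.

Section FracSobolev.
Variable R : realType.

(* The Euclidean norm on R^d = 'rV[R]_d (the library's norm on 'rV is the
   max norm, so we define the Euclidean one explicitly). *)
Definition enorm (d : nat) (v : 'rV[R]_d) : R :=
  Num.sqrt (\sum_(i < d) v ord0 i ^+ 2).

Fixpoint iter_lebesgue_int (n : nat) (F : (nat -> R) -> \bar R) : \bar R :=
  match n with
  | 0 => F (fun _ => 0)
  | n'.+1 => (\int[@lebesgue_measure R]_(t in setT)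
               iter_lebesgue_int n'
                 (fun x => F (fun k => if k == n' then t else x k)))%E
  end.

(* Lebesgue integral over R^d of a nonnegative (Borel) function, computed as
   an iterated integral (Tonelli). *)
Definition intRd (d : nat) (f : 'rV[R]_d -> \bar R) : \bar R :=
  iter_lebesgue_int d (fun x => f (\row_(i < d) x i)).

(* Borel measurability of u : R^d -> R (through the product sigma-algebra on
   d.-tuple R, i.e. the Borel sigma-algebra of R^d). *)
Definition rV_of_tuple (d : nat) (t : d.-tuple R) : 'rV[R]_d :=
  \row_(i < d) tnth t i.

Definition measurable_Rd (d : nat) (u : 'rV[R]_d -> R) : Prop :=
  measurable_fun setT (u \o @rV_of_tuple d).

Definition Lp_pow (d : nat) (p : R) (u : 'rV[R]_d -> R) : \bar R :=
  intRd (fun x => ((`|u x|) `^ p)%:E).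

Definition Lp_norm (d : nat) (p : R) (u : 'rV[R]_d -> R) : \bar R :=
  poweR (Lp_pow p u) p^-1.

Definition in_Lp (d : nat) (p : R) (u : 'rV[R]_d -> R) : Prop :=
  measurable_Rd u /\ (Lp_pow p u < +oo)%E.

Definition gagliardo_pow (d : nat) (s p : R) (u : 'rV[R]_d -> R) : \bar R :=
  intRd (fun y => intRd (fun x =>
    ((`|u x - u y| `^ p) / (enorm (x - y) `^ (d%:R + s * p)))%:E)).

Definition gagliardo (d : nat) (s p : R) (u : 'rV[R]_d -> R) : \bar R :=
  poweR (gagliardo_pow s p u) p^-1.

Fixpoint iter_derive (d : nat) (vs : seq 'rV[R]_d) (f : 'rV[R]_d -> R)
  : 'rV[R]_d -> R :=
  match vs with
  | [::] => f
  | v :: vs' => (fun x => derive (iter_derive vs' f) x v)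
  end.

Definition smooth (d : nat) (f : 'rV[R]_d -> R) : Prop :=
  forall (vs : seq 'rV[R]_d) (x : 'rV[R]_d), differentiable (iter_derive vs f) x.

Definition Cc_infty (d : nat) (f : 'rV[R]_d -> R) : Prop :=
  smooth f /\ compact (closure [set x | f x != 0]).

(* W^{s,p}(R^d): completion of C_c^infty under (||.||_p^p + [.]^p)^(1/p),
   realised inside L^p: the limits in that norm of sequences of C_c^infty
   functions. *)
Definition in_Wsp (d : nat) (s p : R) (u : 'rV[R]_d -> R) : Prop :=
  measurable_Rd u /\
  exists phi : nat -> 'rV[R]_d -> R,
    (forall n, Cc_infty (phi n)) /\
    let w n := (fun x => u x - phi n x) in
    ((fun n => Lp_pow p (w n) + gagliardo_pow s p (w n))%E @ \oo --> 0%E).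

(* D^{p,q}_s = (W^{s,p} cap L^q) \ {0}; u <> 0 means u is not a.e. zero. *)
Definition in_Dpqs (d : nat) (s p q : R) (u : 'rV[R]_d -> R) : Prop :=
  in_Wsp s p u /\ in_Lp q u /\ (0 < Lp_pow p u)%E.

End FracSobolev.

(* Main.v *)
(* Write [D y] for the inner integral of the Gagliardo energy. By Chebyshev's
   inequality the set where [|u| > |u y| / 2] has measure at most
   [(2 / |u y|)^Q int |u|^Q]. On at least half of a cube around [y] of twice this
   volume, [|u x - u y| >= |u y| / 2], hence
   [|u y|^(p + Q s p / d) <= C (int |u|^Q)^(s p / d) D y]. Integrating in [y] turns
   control of [L^Q] into control of [L^(p + Q s p / d)]. Starting from [Q = q],
   these exponents increase to the critical exponent [d p / (d - s p)], which
   exceeds [r]; interpolation then gives the inequality for [r] without the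
   endpoint Sobolev embedding. The set of admissible constants is closed, and
   bounded below by a positive number because a smooth bump has finite energy, so
   its infimum is the optimal constant. *)

Require Import Defs.
From HB Require Import structures.
From mathcomp Require Import all_boot all_order all_algebra.
From mathcomp Require Import all_classical all_reals all_analysis.
From mathcomp Require Import measurable_realfun lra ring.
Set Implicit Arguments. Unset Strict Implicit. Unset Printing Implicit Defensive.
Import Order.TTheory GRing.Theory Num.Theory.
Import numFieldNormedType.Exports.
Local Open Scope classical_set_scope.
Local Open Scope ring_scope.

Section RealPowers.
Variable R : realType.

Lemma powR_ge1 (x e : R) : 0 <= e -> 1 <= x -> 1 <= x `^ e.
Proof. by move=> e_ge0 x_ge1; rewrite -(powRr0 x) ler_powR. Qed.

Lemma powR_lt1 (x a : R) : 1 < x -> a < 0 -> x `^ a < 1.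
Proof.
move=> x_gt1 a_lt0; have x_gt0 : 0 < x by exact: lt_trans x_gt1.
rewrite -[a]opprK powRN invf_lt1 ?powR_gt0//.
have -> : 1 = 1 `^ (- a) by rewrite powR1.
by rewrite gt0_ltr_powR ?oppr_gt0 ?nnegrE ?(ltW x_gt0).
Qed.

Lemma powR_exprn (x a : R) n : 0 <= x -> (x `^ a) ^+ n = (x ^+ n) `^ a.
Proof. by move=> x_ge0; rewrite -!powR_mulrn ?powR_ge0// -!powRrM mulrC. Qed.

Lemma powR_weighted_AGM (x y t : R) : 0 <= x -> 0 <= y -> 0 < t < 1 ->
  x `^ (1 - t) * y `^ t <= (1 - t) * x + t * y.
Proof.
move=> x_ge0 y_ge0 /andP[t_gt0 t_lt1]; have t1_gt0 : 0 < 1 - t by rewrite subr_gt0.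
have := @conjugate_powR _ (x `^ (1 - t)) (y `^ t) (1 - t)^-1 t^-1.
rewrite !powR_ge0 !invr_gt0 !invrK -!powRrM !mulfV ?gt_eqF// !powRr1//.
by rewrite [x * _]mulrC [y * _]mulrC; apply=> //; rewrite subrK.
Qed.
End RealPowers.

(** * Lebesgue integration on [R^d] *)

Section NonnegativeIntegral.
Context {dT : measure_display} {T : measurableType dT} {R : realType}.
Variable mu : {measure set T -> \bar R}.
Implicit Types f g : T -> \bar R.

Lemma ge0_le_integralT f g : (forall t, 0 <= f t)%E -> (forall t, f t <= g t)%E ->
  (\int[mu]_t f t <= \int[mu]_t g t)%E.
Proof.
move=> f_ge0 fg; have g_ge0 t : (0 <= g t)%E by exact: le_trans (fg t).
rewrite !ge0_integralTE//; apply: le_ereal_sup => _ [h hf <-].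
by exists h => // t; exact: le_trans (hf t) (fg t).
Qed.

Lemma ge0_integral_eq0 f g : (forall t, 0 <= f t)%E -> (forall t, 0 <= g t)%E ->
  measurable_fun setT f -> measurable_fun setT g ->
  (forall t, f t = 0 -> g t = 0)%E ->
  (\int[mu]_t f t = 0)%E -> (\int[mu]_t g t = 0)%E.
Proof.
move=> f_ge0 g_ge0 mf mg fg0 intf0.
have : ae_eq mu setT f (cst 0%E).
  apply/ae_eq_integral_abs => //; rewrite -[RHS]intf0.
  by apply: eq_integral => t _; rewrite gee0_abs.
move=> f_ae0; rewrite -(integral0 mu setT); apply: ge0_ae_eq_integral => //.
by apply: filterS f_ae0 => t /= ft0 _; exact: fg0 (ft0 I).
Qed.
End NonnegativeIntegral.

Lemma integral_indic_itv (R : realType) (a b : R) : a <= b ->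
  (\int[@lebesgue_measure R]_t (\1_(`[a, b]%classic) t)%:E = (b - a)%:E)%E.
Proof.
move=> ab; rewrite integral_indic//= setIT.
have := lebesgue_measure_itv `[a, b]; rewrite /= lte_fin => ->.
by move: ab; rewrite le_eqVlt => /predU1P[->|->]; rewrite ?ltxx ?subrr.
Qed.

Section RowExtension.
Variable R : realType.

Definition rV_rcons (d : nat) (x : 'rV[R]_d) (t : R) : 'rV[R]_d.+1 :=
  \row_i oapp (x ord0) t (unlift ord_max i).

Lemma rV_rcons_lift (d : nat) (x : 'rV[R]_d) t (i : 'I_d) :
  rV_rcons x t ord0 (lift ord_max i) = x ord0 i.
Proof. by rewrite mxE liftK. Qed.

Lemma rV_rcons_max (d : nat) (x : 'rV[R]_d) t : rV_rcons x t ord0 ord_max = t.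
Proof. by rewrite mxE unlift_none. Qed.

Lemma intRd0 (f : 'rV[R]_0 -> \bar R) : intRd f = f 0.
Proof. by rewrite /intRd /=; congr f; apply/rowP => -[]. Qed.

Lemma intRdS (d : nat) (f : 'rV[R]_d.+1 -> \bar R) :
  intRd f = (\int[@lebesgue_measure R]_t intRd (fun x => f (rV_rcons x t)))%E.
Proof.
rewrite /intRd /=; apply: eq_integral => t _.
congr iter_lebesgue_int; apply: funext => x; congr f; apply/rowP => i.
case: (unliftP ord_max i) => [j|] ->; last by rewrite rV_rcons_max mxE eqxx.
by rewrite rV_rcons_lift !mxE lift_max ltn_eqF.
Qed.
End RowExtension.

Section Measurability.
Variable R : realType.

Definition emeasurable_Rd (d : nat) (f : 'rV[R]_d -> \bar R) : Prop :=
  measurable_fun setT (f \o @rV_of_tuple R d).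

Section Composition.
Context {dT : measure_display} {T : measurableType dT} {d : nat}.
Context {dV : measure_display} {V : measurableType dV}.

Lemma measurable_mktuple (X : T -> 'I_d -> R) :
  (forall i, measurable_fun setT (X ^~ i)) ->
  measurable_fun setT (fun t => [tuple X t i | i < d]).
Proof.
move=> mX; apply/measurable_fun_tnthP => i.
rewrite (_ : _ \o _ = X ^~ i); first exact: mX.
by apply: funext => t /=; rewrite tnth_mktuple.
Qed.

Lemma measurable_rV_comp (f : 'rV[R]_d -> V) (X : T -> 'rV[R]_d) :
  measurable_fun setT (f \o @rV_of_tuple R d) ->
  (forall i, measurable_fun setT (fun t => X t ord0 i)) ->
  measurable_fun setT (f \o X).
Proof.
move=> mf mX; pose Y t := [tuple X t ord0 i | i < d].
have -> : f \o X = (f \o @rV_of_tuple R d) \o Y.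
  by apply: funext => t /=; congr f; apply/rowP => i; rewrite mxE tnth_mktuple.
by apply: measurableT_comp => //; exact: measurable_mktuple.
Qed.
End Composition.

Lemma measurable_rV_coord (d : nat) (i : 'I_d) :
  measurable_fun setT (fun t : d.-tuple R => rV_of_tuple t ord0 i).
Proof. by under eq_fun do rewrite mxE; exact: measurable_tnth. Qed.

Lemma measurable_rV_rcons (dT : measure_display) (T : measurableType dT)
    (d : nat) (X : T -> 'rV[R]_d) (g : T -> R) :
  (forall i, measurable_fun setT (fun t => X t ord0 i)) ->
  measurable_fun setT g ->
  forall i, measurable_fun setT (fun t => rV_rcons (X t) (g t) ord0 i).
Proof.
move=> mX mg i; case: (unliftP ord_max i) => [j|] ->.
  by under eq_fun do rewrite rV_rcons_lift; exact: mX.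
by under eq_fun do rewrite rV_rcons_max; exact: mg.
Qed.

Lemma emeasurable_Rd_rcons (d : nat) (f : 'rV[R]_d.+1 -> \bar R) t :
  emeasurable_Rd f -> emeasurable_Rd (fun x => f (rV_rcons x t)).
Proof.
move=> mf; apply: (measurable_rV_comp mf (X := fun z => rV_rcons (rV_of_tuple z) t)).
apply: (@measurable_rV_rcons _ _ _ (@rV_of_tuple R d) (cst t)) => //.
exact: measurable_rV_coord.
Qed.

Lemma intRd_ge0 (d : nat) (f : 'rV[R]_d -> \bar R) :
  (forall x, 0 <= f x)%E -> (0 <= intRd f)%E.
Proof.
elim: d f => [|d IHd] f f_ge0; first by rewrite intRd0.
by rewrite intRdS; apply: integral_ge0 => t _; exact: IHd.
Qed.

Lemma measurable_intRd (dT : measure_display) (T : measurableType dT) (d : nat)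
    (f : T -> 'rV[R]_d -> \bar R) :
  (forall t x, 0 <= f t x)%E ->
  measurable_fun setT (fun z : T * d.-tuple R => f z.1 (rV_of_tuple z.2)) ->
  measurable_fun setT (fun t => intRd (f t)).
Proof.
elim: d dT T f => [|d IHd] dT T f f_ge0 mf.
  under eq_fun do rewrite intRd0.
  have mpair : measurable_fun setT (fun t : T => (t, [tuple] : 0.-tuple R)).
    exact: measurable_fun_pair.
  have := measurableT_comp mf mpair; apply: eq_measurable_fun => t _ /=.
  by congr f; apply/rowP => -[].
under eq_fun do rewrite intRdS.
pose g (z : T * R) := intRd (fun x => f z.1 (rV_rcons x z.2)).
apply: (@measurable_fun_fubini_tonelli_F _ _ _ _ _ (@lebesgue_measure R) g); last first.
  by move=> z; exact: intRd_ge0.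
apply: (IHd _ _ (fun z x => f z.1 (rV_rcons x z.2))) => [z x|]; first exact: f_ge0.
pose extend (z : (T * R) * d.-tuple R) := (z.1.1,
  [tuple rV_rcons (rV_of_tuple z.2) z.1.2 ord0 i | i < d.+1]).
rewrite (_ : (fun _ => _) = (fun z => f z.1 (rV_of_tuple z.2)) \o extend); last first.
  by apply: funext => z /=; congr f; apply/rowP => i; rewrite [RHS]mxE tnth_mktuple.
apply: measurableT_comp => //; apply: measurable_fun_pair.
  exact: measurableT_comp.
apply: measurable_mktuple => i.
apply: (@measurable_rV_rcons _ _ _ (fun z : (T * R) * d.-tuple R => rV_of_tuple z.2)
  (fun z => z.1.2)); last exact: measurableT_comp.
by move=> j; exact: (measurableT_comp (measurable_rV_coord j)).
Qed.

Lemma measurable_intRd_rcons (d : nat) (f : 'rV[R]_d.+1 -> \bar R) :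
  (forall x, 0 <= f x)%E -> emeasurable_Rd f ->
  measurable_fun setT (fun t => intRd (fun x => f (rV_rcons x t))).
Proof.
move=> f_ge0 mf; apply: (measurable_intRd (f := fun t x => f (rV_rcons x t))) => //.
apply: (measurable_rV_comp mf
  (X := fun z : R * d.-tuple R => rV_rcons (rV_of_tuple z.2) z.1)).
apply: (@measurable_rV_rcons _ _ _ (fun z : R * d.-tuple R => rV_of_tuple z.2) fst) => //.
by move=> i; exact: (measurableT_comp (measurable_rV_coord i)).
Qed.
End Measurability.

Section IntegralProperties.
Variable R : realType.
Implicit Types d : nat.

Lemma le_intRd d (f g : 'rV[R]_d -> \bar R) :
  (forall x, 0 <= f x)%E -> (forall x, f x <= g x)%E -> (intRd f <= intRd g)%E.
Proof.
elim: d f g => [|d IHd] f g f_ge0 fg; first by rewrite !intRd0.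
rewrite !intRdS; apply: ge0_le_integralT => t; first exact: intRd_ge0.
exact: IHd.
Qed.

Lemma intRd_cst0 d : intRd (fun _ : 'rV[R]_d => 0%E) = 0%E.
Proof.
elim: d => [|d IHd]; first by rewrite intRd0.
by rewrite intRdS IHd integral0.
Qed.

Lemma intRdD d (f g : 'rV[R]_d -> \bar R) :
  (forall x, 0 <= f x)%E -> (forall x, 0 <= g x)%E ->
  emeasurable_Rd f -> emeasurable_Rd g ->
  intRd (fun x => f x + g x)%E = (intRd f + intRd g)%E.
Proof.
elim: d f g => [|d IHd] f g f_ge0 g_ge0 mf mg; first by rewrite !intRd0.
rewrite !intRdS -ge0_integralD//.
- by apply: eq_integral => t _; rewrite IHd//; exact: emeasurable_Rd_rcons.
- by move=> t _; exact: intRd_ge0.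
- exact: measurable_intRd_rcons.
- by move=> t _; exact: intRd_ge0.
- exact: measurable_intRd_rcons.
Qed.

Lemma intRdZ d (f : 'rV[R]_d -> \bar R) (a : R) :
  0 <= a -> (forall x, 0 <= f x)%E -> emeasurable_Rd f ->
  intRd (fun x => a%:E * f x)%E = (a%:E * intRd f)%E.
Proof.
elim: d f => [|d IHd] f a_ge0 f_ge0 mf; first by rewrite !intRd0.
rewrite !intRdS -ge0_integralZl_EFin//.
- by apply: eq_integral => t _; rewrite IHd//; exact: emeasurable_Rd_rcons.
- by move=> t _; exact: intRd_ge0.
- exact: measurable_intRd_rcons.
Qed.

Lemma intRd_nneseries d (f : nat -> 'rV[R]_d -> \bar R) :
  (forall k x, 0 <= f k x)%E -> (forall k, emeasurable_Rd (f k)) ->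
  intRd (fun x => \sum_(k <oo) f k x)%E = (\sum_(k <oo) intRd (f k))%E.
Proof.
elim: d f => [|d IHd] f f_ge0 mf.
  by rewrite intRd0; apply: eq_eseriesr => k _; rewrite intRd0.
rewrite intRdS (eq_eseriesr (fun k _ => intRdS (f k))) -integral_nneseries//.
- apply: eq_integral => t _; rewrite (IHd (fun k x => f k (rV_rcons x t)))// => k.
  exact: emeasurable_Rd_rcons.
- by move=> k; exact: measurable_intRd_rcons.
- by move=> k t _; exact: intRd_ge0.
Qed.

Lemma intRd_eq0 d (f g : 'rV[R]_d -> \bar R) :
  (forall x, 0 <= f x)%E -> (forall x, 0 <= g x)%E ->
  emeasurable_Rd f -> emeasurable_Rd g -> (forall x, f x = 0 -> g x = 0)%E ->
  intRd f = 0%E -> intRd g = 0%E.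
Proof.
elim: d f g => [|d IHd] f g f_ge0 g_ge0 mf mg fg0; first by rewrite !intRd0; exact: fg0.
rewrite !intRdS; apply: ge0_integral_eq0.
- by move=> t; exact: intRd_ge0.
- by move=> t; exact: intRd_ge0.
- exact: measurable_intRd_rcons.
- exact: measurable_intRd_rcons.
- by move=> t; apply: IHd => // [||x]; [exact: emeasurable_Rd_rcons..|exact: fg0].
Qed.

Lemma emeasurable_Rd_prod d (h : 'I_d -> R -> R) :
  (forall i, measurable_fun setT (h i)) ->
  emeasurable_Rd (fun x => (\prod_i h i (x ord0 i))%:E).
Proof.
move=> mh; apply/measurable_EFinP.
apply: measurable_prod => i _; apply: measurableT_comp => //.
exact: measurable_rV_coord.
Qed.

Lemma intRd_prod d (h : 'I_d -> R -> R) :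
  (forall i t, 0 <= h i t) -> (forall i, measurable_fun setT (h i)) ->
  intRd (fun x => (\prod_i h i (x ord0 i))%:E) =
  (\prod_i \int[@lebesgue_measure R]_t (h i t)%:E)%E.
Proof.
elim: d h => [|d IHd] h h_ge0 mh; first by rewrite intRd0 !big_ord0.
rewrite intRdS [RHS]big_ord_recr /=.
rewrite -IHd//; set I := intRd _; have I_ge0 : (0 <= I)%E.
  by apply: intRd_ge0 => x; rewrite lee_fin prodr_ge0.
rewrite -ge0_integralZl//; last 2 first.
- by apply/measurable_EFinP; exact: mh.
- by move=> t _; rewrite lee_fin.
apply: eq_integral => t _; rewrite muleC /I -intRdZ//.
- congr intRd; apply: funext => x; rewrite -EFinM big_ord_recr /= mulrC.
  rewrite rV_rcons_max; congr (_ * _)%:E; apply: eq_bigr => i _.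
  have -> : widen_ord (leqnSn d) i = lift ord_max i.
    by apply: ord_inj; rewrite lift_max.
  by rewrite rV_rcons_lift.
- by move=> x; rewrite lee_fin prodr_ge0.
- exact: (emeasurable_Rd_prod (fun i => mh (widen_ord (leqnSn d) i))).
Qed.
End IntegralProperties.

Section Cubes.
Variables (R : realType) (d : nat).
Implicit Types (c x : 'rV[R]_d) (rho : R).

Lemma mx_norm_leP x rho : 0 <= rho ->
  reflect (forall i, `|x ord0 i| <= rho) (`|x| <= rho).
Proof.
move=> rho_ge0; rewrite [`|x|]mx_normrE; apply: (iffP (bigmax_leP _ _ _ _)).
  by move=> [_ x_le] i; exact: (x_le (ord0, i)).
by move=> x_le; split=> // -[i j] _ /=; rewrite (ord1 i).
Qed.

Lemma norm_coord_le x i : `|x ord0 i| <= `|x|.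
Proof. by move: i; apply/mx_norm_leP. Qed.

(* The norm of ['rV[R]_d] is the sup norm, so its closed balls are cubes. *)
Definition cube_ind c rho x : \bar R := (`|x - c| <= rho)%R%:R%:E.

Lemma cube_ind_ge0 c rho x : (0 <= cube_ind c rho x)%E.
Proof. by rewrite lee_fin. Qed.

Lemma cube_ind_prod c rho : 0 <= rho ->
  cube_ind c rho =
  fun x => (\prod_i \1_(`[c ord0 i - rho, c ord0 i + rho]%classic) (x ord0 i))%:E.
Proof.
move=> rho_ge0; apply: funext => x; congr EFin.
have itvE i : (x ord0 i \in `[c ord0 i - rho, c ord0 i + rho]%classic) =
    (`|(x - c) ord0 i| <= rho) by rewrite mem_setE in_itv/= !mxE ler_distl.
case: mx_norm_leP => // [x_near|/existsNP[i x_far]].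
  by rewrite big1// => i _; rewrite indicE itvE x_near.
by rewrite (bigD1 i)//= indicE itvE (negbTE (introN idP x_far)) mul0r.
Qed.

Lemma emeasurable_cube_ind c rho : 0 <= rho -> emeasurable_Rd (cube_ind c rho).
Proof.
move=> rho_ge0; rewrite cube_ind_prod//.
apply: (emeasurable_Rd_prod (h := fun i => \1_(`[c ord0 i - rho, c ord0 i + rho]))).
by move=> i; apply: measurable_indic; exact: measurable_itv.
Qed.

Lemma intRd_cube c rho : 0 <= rho -> intRd (cube_ind c rho) = ((2 * rho) ^+ d)%:E.
Proof.
move=> rho_ge0; rewrite cube_ind_prod//.
rewrite (intRd_prod (h := fun i => \1_(`[c ord0 i - rho, c ord0 i + rho]))) => [|//|i].
  under eq_bigr => i _.
    rewrite integral_indic_itv; last by rewrite lerD2l; lra.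
    rewrite (_ : _ - _ = 2 * rho); last by ring.
    over.
  by rewrite prodEFin prodr_const card_ord.
apply: measurable_indic; exact: measurable_itv.
Qed.
End Cubes.

(** * The Gagliardo energy *)

Section Gagliardo.
Variables (R : realType) (d : nat).
Implicit Types (u : 'rV[R]_d -> R) (x y : 'rV[R]_d).

Lemma coord_le_enorm x i : `|x ord0 i| <= enorm x.
Proof.
rewrite /enorm -sqrtr_sqr ler_wsqrtr// (bigD1 i)//= lerDl.
by apply: sumr_ge0 => j _; exact: sqr_ge0.
Qed.

Lemma enorm_ge0 x : 0 <= enorm x.
Proof. exact: sqrtr_ge0. Qed.

Lemma norm_le_enorm x : `|x| <= enorm x.
Proof. by apply/mx_norm_leP => [|i]; [exact: enorm_ge0|exact: coord_le_enorm]. Qed.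

Lemma enorm_le_norm x : enorm x <= Num.sqrt d%:R * `|x|.
Proof.
rewrite /enorm -[X in _ * X]ger0_norm// -sqrtr_sqr -sqrtrM ?ler0n// ler_wsqrtr//.
rewrite -[d in d%:R]card_ord mulr_natl -sumr_const; apply: ler_sum => i _.
by rewrite -(real_normK (num_real _)) ler_sqr ?nnegrE// norm_coord_le.
Qed.

Lemma measurable_enorm (dT : measure_display) (T : measurableType dT)
    (X : T -> 'rV[R]_d) :
  (forall i, measurable_fun setT (fun t => X t ord0 i)) ->
  measurable_fun setT (fun t => enorm (X t)).
Proof.
move=> mX; apply: measurableT_comp.
  by apply: continuous_measurable_fun; exact: sqrt_continuous.
by apply: measurable_sum => i; exact: measurable_funX.
Qed.

Lemma emeasurable_RdZ (a : R) (f : 'rV[R]_d -> \bar R) :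
  emeasurable_Rd f -> emeasurable_Rd (fun x => a%:E * f x)%E.
Proof. by move=> mf; apply: emeasurable_funM. Qed.

Lemma emeasurable_powR (p : R) u : measurable_Rd u ->
  emeasurable_Rd (fun x => (`|u x| `^ p)%:E).
Proof.
move=> mu; apply/measurable_EFinP.
by apply: (measurableT_comp (measurable_powR p)); exact: measurableT_comp.
Qed.

Lemma Lp_pow_ge0 (p : R) u : (0 <= Lp_pow p u)%E.
Proof. by apply: intRd_ge0 => x; rewrite lee_fin powR_ge0. Qed.

Lemma Lp_pow_eq0 (p q : R) u : p != 0 -> q != 0 -> measurable_Rd u ->
  Lp_pow q u = 0%E -> Lp_pow p u = 0%E.
Proof.
move=> p_neq0 q_neq0 mu; apply: intRd_eq0 => [x|x|||x].
- by rewrite lee_fin powR_ge0.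
- by rewrite lee_fin powR_ge0.
- exact: emeasurable_powR.
- exact: emeasurable_powR.
- by move=> [/eqP]; rewrite powR_eq0 => /andP[/eqP -> _]; rewrite powR0.
Qed.

Definition gkernel (s p : R) u y x : \bar R :=
  (`|u x - u y| `^ p / enorm (x - y) `^ (d%:R + s * p))%:E.

Definition gdensity (s p : R) u y : \bar R := intRd (gkernel s p u y).

Lemma gkernel_ge0 s p u y x : (0 <= gkernel s p u y x)%E.
Proof. by rewrite lee_fin divr_ge0// powR_ge0. Qed.

Lemma gdensity_ge0 s p u y : (0 <= gdensity s p u y)%E.
Proof. by apply: intRd_ge0 => x; exact: gkernel_ge0. Qed.

Lemma gagliardo_pow_ge0 s p u : (0 <= gagliardo_pow s p u)%E.
Proof. by apply: intRd_ge0 => y; exact: gdensity_ge0. Qed.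

Lemma measurable_gkernel s p u (dT : measure_display) (T : measurableType dT)
    (Y X : T -> 'rV[R]_d) :
  measurable_Rd u ->
  (forall i, measurable_fun setT (fun t => Y t ord0 i)) ->
  (forall i, measurable_fun setT (fun t => X t ord0 i)) ->
  measurable_fun setT (fun t => gkernel s p u (Y t) (X t)).
Proof.
move=> mu mY mX; apply/measurable_EFinP; apply: measurable_funM.
  apply: (measurableT_comp (measurable_powR p)); apply: measurableT_comp => //.
  apply: measurable_funB; exact: (measurable_rV_comp mu).
under eq_fun do rewrite -powRN.
apply: (measurableT_comp (measurable_powR _)).
apply: measurable_enorm => i; under eq_fun do rewrite !mxE.
exact: measurable_funB.
Qed.

Lemma emeasurable_gkernel s p u y : measurable_Rd u ->
  emeasurable_Rd (gkernel s p u y).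
Proof.
move=> mu; apply: (measurable_gkernel s p mu (Y := fun=> y)) => // i.
exact: measurable_rV_coord.
Qed.

Lemma emeasurable_gdensity s p u : measurable_Rd u -> emeasurable_Rd (gdensity s p u).
Proof.
move=> mu; apply: (measurable_intRd (f := fun t => gkernel s p u (rV_of_tuple t))).
  by move=> t x; exact: gkernel_ge0.
apply: measurable_gkernel => // i.
- exact: (measurableT_comp (measurable_rV_coord i)).
- exact: (measurableT_comp (measurable_rV_coord i)).
Qed.
End Gagliardo.

(** * Self-improving integrability *)

Section SelfImprovement.
Variables (R : realType) (d : nat) (p s : R).
Hypotheses (d_gt0 : (0 < d)%N) (p_gt0 : 0 < p) (s_gt0 : 0 < s).
Implicit Types (u : 'rV[R]_d -> R) (Q : R).

Definition gain_ratio : R := s * p / d%:R.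

Let dR_gt0 : 0 < d%:R :> R. Proof. by rewrite ltr0n. Qed.
Let dsp_gt0 : 0 < d%:R + s * p. Proof. by rewrite addr_gt0// mulr_gt0. Qed.

Lemma gain_ratio_gt0 : 0 < gain_ratio.
Proof. by rewrite divr_gt0// mulr_gt0. Qed.

(* Where [|u x| <= |u y| / 2], the increment [|u x - u y|] is at least
   [|u y| / 2] and the kernel is large; elsewhere [|u x|^Q] is. *)
Lemma cube_ind_le_gkernel_add u y x (rho Q : R) :
  0 < rho -> 0 < Q -> u y != 0 ->
  (cube_ind y rho x <=
   ((2 / `|u y|) `^ p * (Num.sqrt d%:R * rho) `^ (d%:R + s * p))%:E *
     gkernel s p u y x +
   ((2 / `|u y|) `^ Q)%:E * (`|u x| `^ Q)%:E)%E.
Proof.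
move=> rho_gt0 Q_gt0 uy_neq0; set K := _ * _ `^ (_ + _).
have uy_gt0 : 0 < `|u y| by rewrite normr_gt0.
pose w : R := 2 / `|u y|; have w_gt0 : 0 < w by rewrite divr_gt0.
have uyw : `|u y| * w = 2 by rewrite mulrCA divff ?mulr1// gt_eqF.
have kernel_term_ge0 : (0 <= K%:E * gkernel s p u y x)%E.
  by rewrite mule_ge0 ?gkernel_ge0// lee_fin mulr_ge0 ?powR_ge0.
have tail_term_ge0 : (0 <= (w `^ Q)%:E * (`|u x| `^ Q)%:E)%E.
  by rewrite -EFinM lee_fin mulr_ge0 ?powR_ge0.
rewrite /cube_ind; have [xy_le|_] := boolP (`|x - y| <= rho); last exact: adde_ge0.
have [ux_small|ux_large] := leP (`|u x| * w) 1; last first.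
  apply: le_trans (leeDr _ kernel_term_ge0).
  rewrite -EFinM lee_fin -powRM ?(ltW w_gt0)// mulrC.
  by apply: powR_ge1; exact: ltW.
apply: le_trans (leeDl _ tail_term_ge0).
have dist_gt0 : 0 < enorm (x - y).
  apply: lt_le_trans (norm_le_enorm _); rewrite normr_gt0 subr_eq0.
  by apply: contraTneq ux_small => ->; rewrite uyw -ltNge ltr1n.
rewrite -EFinM lee_fin mulrACA -powRM ?(ltW w_gt0)// -[leLHS](mulr1 1) ler_pM//.
  apply: powR_ge1; first exact: ltW.
  have /(ler_wpM2r (ltW w_gt0)) : `|u y| <= `|u x - u y| + `|u x|.
    by rewrite distrC; have := ler_normD (u y - u x) (u x); rewrite subrK.
  by rewrite uyw mulrDl [w * _]mulrC; lra.
rewrite ler_pdivlMr ?powR_gt0// mul1r.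
have [rho_ge0 dsp_ge0] : 0 <= rho /\ 0 <= d%:R + s * p by split; exact: ltW.
rewrite ge0_ler_powR ?nnegrE ?enorm_ge0 ?mulr_ge0 ?sqrtr_ge0//.
by apply: le_trans (enorm_le_norm _) _; rewrite ler_wpM2l// sqrtr_ge0.
Qed.

Lemma cube_volume_le_gdensity_add u y (rho Q : R) :
  measurable_Rd u -> 0 < rho -> 0 < Q -> u y != 0 ->
  (((2 * rho) ^+ d)%:E <=
   ((2 / `|u y|) `^ p * (Num.sqrt d%:R * rho) `^ (d%:R + s * p))%:E *
     gdensity s p u y +
   ((2 / `|u y|) `^ Q)%:E * Lp_pow Q u)%E.
Proof.
move=> mu rho_gt0 Q_gt0 uy_neq0; set K := _ * _ `^ (_ + _); set W := _ `^ Q.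
have K_ge0 : 0 <= K by rewrite mulr_ge0 ?powR_ge0.
have pow_ge0 x : (0 <= (`|u x| `^ Q)%:E)%E by rewrite lee_fin powR_ge0.
have kernel_ge0 x := gkernel_ge0 s p u y x.
have mkernel := emeasurable_gkernel s p y mu.
have mpow := emeasurable_powR Q mu.
rewrite -(intRd_cube y (ltW rho_gt0)) /gdensity /Lp_pow.
rewrite -(intRdZ K_ge0)// -(intRdZ (powR_ge0 _ Q : 0 <= W))// -intRdD.
- apply: le_intRd => x; first exact: cube_ind_ge0.
  exact: cube_ind_le_gkernel_add.
- by move=> x; rewrite mule_ge0.
- by move=> x; rewrite mule_ge0// lee_fin powR_ge0.
- exact: emeasurable_RdZ.
- exact: emeasurable_RdZ.
Qed.

Definition gdensity_cst : R :=
  (Num.sqrt d%:R / 2) `^ (d%:R + s * p) * 2 `^ (1 + gain_ratio).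

Lemma gdensity_cst_gt0 : 0 < gdensity_cst.
Proof. by rewrite mulr_gt0 ?powR_gt0// divr_gt0// sqrtr_gt0. Qed.

(* The cube around [y] is chosen of volume [2 * M], twice the bound on the measure
   of the set where [|u| > |u y| / 2]. *)
Lemma gdensity_lower_bound u y (Q M : R) :
  measurable_Rd u -> 0 < Q -> u y != 0 -> 0 < M ->
  (((2 / `|u y|) `^ Q)%:E * Lp_pow Q u <= M%:E)%E ->
  (1 <= (gdensity_cst * ((2 / `|u y|) `^ p * M `^ gain_ratio))%:E *
        gdensity s p u y)%E.
Proof.
move=> mu Q_gt0 uy_neq0 M_gt0 tail_le.
have M2_gt0 : 0 < 2 * M by rewrite mulr_gt0.
pose side := (2 * M) `^ d%:R^-1; have side_gt0 : 0 < side by rewrite powR_gt0.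
have volume : (2 * (side / 2)) ^+ d = 2 * M.
  rewrite mulrC divfK// -powR_mulrn ?(ltW side_gt0)// -powRrM.
  by rewrite mulVf ?gt_eqF// powRr1// ltW.
have radius_gt0 : 0 < side / 2 by rewrite divr_gt0.
have := cube_volume_le_gdensity_add mu radius_gt0 Q_gt0 uy_neq0.
set K := _ * _ `^ (_ + _); rewrite volume => volume_le.
have K_factor : K = M * (gdensity_cst * ((2 / `|u y|) `^ p * M `^ gain_ratio)).
  have side_pow : side `^ (d%:R + s * p) = (2 * M) `^ (1 + gain_ratio).
    by rewrite -powRrM mulrDr mulVf ?gt_eqF// [_^-1 * (s * p)]mulrC.
  rewrite /K; have -> : Num.sqrt d%:R * (side / 2) = Num.sqrt d%:R / 2 * side by ring.
  rewrite [(_ * side) `^ _]powRM ?(ltW side_gt0) ?divr_ge0 ?sqrtr_ge0// side_pow.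
  rewrite [(2 * M) `^ _]powRM ?(ltW M_gt0)// [M `^ (1 + _)]powRD ?powRr1 ?(ltW M_gt0)//.
    by rewrite /gdensity_cst; ring.
  by rewrite (gt_eqF M_gt0) implybT.
have M_le : (M%:E <= K%:E * gdensity s p u y)%E.
  rewrite -(leeD2rE _ _ (_ : M%:E \is a fin_num))// -EFinD.
  rewrite -[M + M]mulr2n -mulr_natl; apply: le_trans volume_le _.
  exact: leeD2l.
rewrite -(@lee_pmul2l _ M%:E)// mule1 muleA -EFinM -K_factor.
exact: M_le.
Qed.

Lemma powR_le_gdensity u y (Q B : R) :
  measurable_Rd u -> 0 < Q -> 0 < B -> (Lp_pow Q u <= B%:E)%E ->
  ((`|u y| `^ (p + Q * gain_ratio))%:E <=
   (gdensity_cst * 2 `^ (p + Q * gain_ratio) * B `^ gain_ratio)%:E *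
   gdensity s p u y)%E.
Proof.
move=> mu Q_gt0 B_gt0 uB; set e := p + Q * gain_ratio.
have e_gt0 : 0 < e by rewrite addr_gt0// mulr_gt0// gain_ratio_gt0.
have [->|uy_neq0] := eqVneq (u y) 0.
  rewrite normr0 powR0 ?gt_eqF// mule_ge0 ?gdensity_ge0// lee_fin.
  by rewrite !mulr_ge0 ?powR_ge0// ltW// gdensity_cst_gt0.
have uy_gt0 : 0 < `|u y| by rewrite normr_gt0.
have M_gt0 : 0 < (2 / `|u y|) `^ Q * B by rewrite mulr_gt0 ?powR_gt0 ?divr_gt0.
have tail_le : (((2 / `|u y|) `^ Q)%:E * Lp_pow Q u <= ((2 / `|u y|) `^ Q * B)%:E)%E.
  by rewrite EFinM lee_wpmul2l// lee_fin powR_ge0.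
have := gdensity_lower_bound mu Q_gt0 uy_neq0 M_gt0 tail_le.
rewrite -(@lee_pmul2l _ (`|u y| `^ e)%:E) ?lte_fin ?powR_gt0// mule1 muleA -EFinM.
suff -> : `|u y| `^ e * (gdensity_cst *
    ((2 / `|u y|) `^ p * ((2 / `|u y|) `^ Q * B) `^ gain_ratio)) =
    gdensity_cst * 2 `^ e * B `^ gain_ratio by [].
rewrite powRM ?powR_ge0 ?(ltW B_gt0)// -powRrM.
have -> : 2 `^ e = `|u y| `^ e * (2 / `|u y|) `^ e.
  by rewrite -powRM ?divr_ge0// mulrCA divff ?mulr1// gt_eqF.
by rewrite [(2 / _) `^ e]powRD ?(gt_eqF e_gt0)//; ring.
Qed.

Lemma Lp_pow_gain u (Q B : R) :
  measurable_Rd u -> 0 < Q -> 0 <= B -> (Lp_pow Q u <= B%:E)%E ->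
  (Lp_pow (p + Q * gain_ratio) u <=
   (gdensity_cst * 2 `^ (p + Q * gain_ratio) * B `^ gain_ratio)%:E *
   gagliardo_pow s p u)%E.
Proof.
move=> mu Q_gt0; set C := gdensity_cst * _.
have e_gt0 : 0 < p + Q * gain_ratio by rewrite addr_gt0// mulr_gt0// gain_ratio_gt0.
have C_ge0 b : 0 <= C * b `^ gain_ratio.
  by rewrite !mulr_ge0 ?powR_ge0// ltW// gdensity_cst_gt0.
rewrite le_eqVlt => /predU1P[<-|B_gt0] uB.
  have uQ0 : Lp_pow Q u = 0%E by apply/eqP; rewrite eq_le uB Lp_pow_ge0.
  rewrite (Lp_pow_eq0 _ _ mu uQ0) ?gt_eqF//.
  by rewrite mule_ge0 ?gagliardo_pow_ge0// lee_fin.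
rewrite -[gagliardo_pow s p u]/(intRd (gdensity s p u)) -intRdZ//.
- apply: le_intRd => y; first by rewrite lee_fin powR_ge0.
  exact: powR_le_gdensity.
- exact: gdensity_ge0.
- exact: emeasurable_gdensity.
Qed.
End SelfImprovement.

(** * Interpolation *)

Section Interpolation.
Variables (R : realType) (d : nat).
Implicit Types u : 'rV[R]_d -> R.

Lemma powR_interpolation (v q Q t A B : R) :
  0 <= v -> 0 < t < 1 -> 0 < A -> 0 < B -> q * (1 - t) + Q * t != 0 ->
  v `^ (q * (1 - t) + Q * t) <=
  A `^ (1 - t) * B `^ t * ((1 - t) * (v `^ q / A) + t * (v `^ Q / B)).
Proof.
move=> v_ge0 t01 A_gt0 B_gt0 r_neq0.
have a_ge0 : 0 <= v `^ q / A by rewrite divr_ge0 ?powR_ge0// ltW.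
have b_ge0 : 0 <= v `^ Q / B by rewrite divr_ge0 ?powR_ge0// ltW.
have -> : v `^ (q * (1 - t) + Q * t) =
    A `^ (1 - t) * B `^ t * ((v `^ q / A) `^ (1 - t) * (v `^ Q / B) `^ t).
  rewrite powRD ?(negbTE r_neq0)// !powRrM mulrACA.
  rewrite -(powRM _ (ltW A_gt0) a_ge0) -(powRM _ (ltW B_gt0) b_ge0).
  by rewrite ![_ * (_ / _)]mulrC !divfK ?gt_eqF.
by rewrite ler_wpM2l ?mulr_ge0 ?powR_ge0// powR_weighted_AGM.
Qed.

Lemma Lp_pow_interpolation u (q Q t A B : R) : measurable_Rd u ->
  Q != 0 -> q * (1 - t) + Q * t != 0 -> 0 < t < 1 -> 0 < A -> 0 <= B ->
  (Lp_pow q u <= A%:E)%E -> (Lp_pow Q u <= B%:E)%E ->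
  (Lp_pow (q * (1 - t) + Q * t) u <= (A `^ (1 - t) * B `^ t)%:E)%E.
Proof.
move=> mu Q_neq0 r_neq0 t01 A_gt0.
rewrite le_eqVlt => /predU1P[<-|B_gt0] uA uB.
  have uQ0 : Lp_pow Q u = 0%E by apply/eqP; rewrite eq_le uB Lp_pow_ge0.
  by rewrite (Lp_pow_eq0 r_neq0 Q_neq0 mu uQ0) lee_fin mulr_ge0 ?powR_ge0.
have [t_ge0 t1_ge0] : 0 <= t /\ 0 <= 1 - t.
  by case/andP: t01 => /ltW t_ge0 /ltW t_le1; rewrite subr_ge0.
pose c := A `^ (1 - t) * B `^ t.
have c_ge0 : 0 <= c by rewrite mulr_ge0 ?powR_ge0.
pose cq := c * (1 - t) / A; pose cQ := c * t / B.
have cq_ge0 : 0 <= cq by apply: divr_ge0; [exact: mulr_ge0|exact: ltW].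
have cQ_ge0 : 0 <= cQ by apply: divr_ge0; [exact: mulr_ge0|exact: ltW].
have pow_ge0 e x : (0 <= (`|u x| `^ e)%:E)%E by rewrite lee_fin powR_ge0.
have mpow e := emeasurable_powR e mu.
apply: (@le_trans _ _ (intRd (fun x => cq%:E * (`|u x| `^ q)%:E +
                                       cQ%:E * (`|u x| `^ Q)%:E)%E)).
  apply: le_intRd => // x; rewrite -!EFinM -EFinD lee_fin.
  apply: le_trans (powR_interpolation _ t01 A_gt0 B_gt0 r_neq0) _ => //.
  by rewrite le_eqVlt; apply/predU1P; left; rewrite /cq /cQ /c; ring.
rewrite intRdD; last 4 first.
- by move=> x; rewrite mule_ge0.
- by move=> x; rewrite mule_ge0.
- exact: emeasurable_RdZ.
- exact: emeasurable_RdZ.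
rewrite !intRdZ//; apply: (@le_trans _ _ (cq%:E * A%:E + cQ%:E * B%:E)%E).
  by apply: leeD; rewrite lee_wpmul2l.
by rewrite -!EFinM !divfK ?gt_eqF// -EFinD lee_fin -mulrDr subrK mulr1.
Qed.
End Interpolation.

(** * The Gagliardo-Nirenberg inequality *)

Section GagliardoNirenberg.
Variables (R : realType) (d : nat) (p s : R).
Hypotheses (d_gt0 : (0 < d)%N) (p_gt0 : 0 < p) (s_gt0 : 0 < s).
Hypothesis sp_lt_d : s * p < d%:R.
Implicit Types (u : 'rV[R]_d -> R) (q Q r : R).

(* Positive exactly below the critical Sobolev exponent [d p / (d - s p)]. *)
Definition sobolev_gap Q : R := d%:R * p - (d%:R - s * p) * Q.

Let dR_gt0 : 0 < d%:R :> R. Proof. by rewrite ltr0n. Qed.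
Let dsp_gt0 : 0 < d%:R - s * p. Proof. by rewrite subr_gt0. Qed.
Let sigma : R := gain_ratio d p s.
Let sigma_gt0 : 0 < sigma. Proof. exact: gain_ratio_gt0. Qed.

Lemma gain_ratio_lt1 : sigma < 1.
Proof. by rewrite ltr_pdivrMr ?mul1r. Qed.

Lemma ltr_sobolev_gap Q r : (sobolev_gap r < sobolev_gap Q) = (Q < r).
Proof. by rewrite ltrD2l ltrN2 ltr_pM2l. Qed.

Lemma ler_sobolev_gap Q r : (sobolev_gap r <= sobolev_gap Q) = (Q <= r).
Proof. by rewrite lerD2l lerN2 ler_pM2l. Qed.

Lemma sobolev_gap_gain Q : sobolev_gap (p + Q * sigma) = sigma * sobolev_gap Q.
Proof. by rewrite /sobolev_gap /sigma /gain_ratio; field; rewrite gt_eqF. Qed.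

Section BaseExponent.
Variable q : R.
Hypotheses (q_gt0 : 0 < q) (gap_gt0 : 0 < sobolev_gap q).

(* The exponents of [gagliardo_pow s p u] and of [Lp_pow q u] that the scalings
   [u |-> c * u] and [u |-> u (l *: _)] impose on a bound for [Lp_pow Q u]. *)
Definition gagliardo_exponent Q : R := d%:R * (Q - q) / sobolev_gap q.
Definition base_exponent Q : R := sobolev_gap Q / sobolev_gap q.

Definition gagliardo_nirenberg_bound Q : Prop :=
  exists2 C : R, 0 < C & forall u (A G : R), measurable_Rd u -> 0 < A -> 0 <= G ->
    (Lp_pow q u <= A%:E)%E -> (gagliardo_pow s p u <= G%:E)%E ->
    (Lp_pow Q u <=
     (C * (G `^ gagliardo_exponent Q * A `^ base_exponent Q))%:E)%E.

Let gap_neq0 : sobolev_gap q != 0. Proof. by rewrite gt_eqF. Qed.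

Lemma gagliardo_nirenberg_bound_base : gagliardo_nirenberg_bound q.
Proof.
exists 1 => // u A G mu A_gt0 G_ge0 uA uG.
rewrite /gagliardo_exponent /base_exponent subrr mulr0 mul0r powRr0 divff//.
by rewrite powRr1 ?mul1r// ltW.
Qed.

Lemma gagliardo_nirenberg_bound_gain Q : q <= Q ->
  gagliardo_nirenberg_bound Q -> gagliardo_nirenberg_bound (p + Q * sigma).
Proof.
move=> qQ [C C_gt0 C_bound]; have Q_gt0 : 0 < Q by exact: lt_le_trans qQ.
set gain := gdensity_cst d p s * 2 `^ (p + Q * sigma).
have gain_gt0 : 0 < gain by rewrite mulr_gt0 ?powR_gt0 ?gdensity_cst_gt0.
exists (gain * C `^ sigma); first by rewrite mulr_gt0 ?powR_gt0.
move=> u A G mu A_gt0 G_ge0 uA uG.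
have a_ge0 : 0 <= gagliardo_exponent Q.
  by rewrite divr_ge0 ?(ltW gap_gt0) ?mulr_ge0 ?subr_ge0.
set B := C * (G `^ gagliardo_exponent Q * A `^ base_exponent Q).
have B_ge0 : 0 <= B by rewrite !mulr_ge0 ?powR_ge0// ltW.
have uB : (Lp_pow Q u <= B%:E)%E by exact: C_bound.
apply: le_trans (Lp_pow_gain d_gt0 p_gt0 s_gt0 mu Q_gt0 B_ge0 uB) _.
apply: (@le_trans _ _ ((gain * B `^ sigma)%:E * G%:E)%E).
  by rewrite lee_wpmul2l// lee_fin mulr_ge0 ?powR_ge0// ltW.
rewrite -EFinM lee_fin le_eqVlt; apply/predU1P; left.
have -> : gagliardo_exponent (p + Q * sigma) = 1 + gagliardo_exponent Q * sigma.
  have := gap_neq0; rewrite /gagliardo_exponent /sobolev_gap /sigma /gain_ratio.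
  by move=> gap_unfolded_neq0; field; rewrite gap_unfolded_neq0 gt_eqF.
have -> : base_exponent (p + Q * sigma) = base_exponent Q * sigma.
  by rewrite /base_exponent sobolev_gap_gain -mulrA mulrC.
rewrite /B powRM ?(ltW C_gt0) ?mulr_ge0 ?powR_ge0// powRM ?powR_ge0// -!powRrM.
rewrite [G `^ (1 + _)]powRD ?powRr1//; first by ring.
by rewrite gt_eqF// ltr_pwDl// mulr_ge0// ltW.
Qed.

Lemma gagliardo_nirenberg_bound_interpolation Q r : q < r -> r < Q ->
  gagliardo_nirenberg_bound Q -> gagliardo_nirenberg_bound r.
Proof.
move=> qr rQ [C C_gt0 C_bound].
have [rq_gt0 Qq_gt0] : 0 < r - q /\ 0 < Q - q by rewrite !subr_gt0 qr (lt_trans qr rQ).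
have Qq_neq0 : Q - q != 0 by rewrite gt_eqF.
pose t := (r - q) / (Q - q).
have t01 : 0 < t < 1 by rewrite divr_gt0// ltr_pdivrMr// mul1r ltrD2r.
have r_convex : r = q * (1 - t) + Q * t by rewrite /t; field.
exists (C `^ t); first by rewrite powR_gt0.
move=> u A G mu A_gt0 G_ge0 uA uG.
have B_ge0 : 0 <= C * (G `^ gagliardo_exponent Q * A `^ base_exponent Q).
  by rewrite !mulr_ge0 ?powR_ge0// ltW.
have Q_neq0 : Q != 0 by rewrite gt_eqF// (lt_trans q_gt0)// (lt_trans qr).
have r_neq0 : r != 0 by rewrite gt_eqF// (lt_trans q_gt0).
rewrite r_convex in r_neq0.
have uB := C_bound _ _ _ mu A_gt0 G_ge0 uA uG.
have := Lp_pow_interpolation mu Q_neq0 r_neq0 t01 A_gt0 B_ge0 uA uB.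
rewrite -r_convex => /le_trans; apply; rewrite lee_fin le_eqVlt; apply/predU1P; left.
have -> : gagliardo_exponent r = gagliardo_exponent Q * t.
  by rewrite /gagliardo_exponent /t; field; rewrite Qq_neq0.
have -> : base_exponent r = (1 - t) + base_exponent Q * t.
  have := gap_neq0; rewrite r_convex /base_exponent /sobolev_gap.
  by move=> gap_unfolded_neq0; field.
rewrite powRM ?(ltW C_gt0) ?mulr_ge0 ?powR_ge0// powRM ?powR_ge0// -!powRrM.
by rewrite [A `^ (1 - t + _)]powRD ?(gt_eqF A_gt0) ?implybT//; ring.
Qed.

(* The gap is multiplied by [sigma < 1] at each step of the iteration, so every
   subcritical exponent is eventually exceeded. *)
Lemma gagliardo_nirenberg_bound_subcritical r :
  q < r -> 0 < sobolev_gap r -> gagliardo_nirenberg_bound r.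
Proof.
move=> qr r_subcritical.
pose Q k := iter k (fun Q => p + Q * sigma) q.
have gapQ k : sobolev_gap (Q k) = sigma ^+ k * sobolev_gap q.
  elim: k => [|k IHk]; first by rewrite expr0 mul1r.
  by rewrite /Q iterS sobolev_gap_gain IHk exprS mulrA.
have qQ k : q <= Q k.
  rewrite -ler_sobolev_gap gapQ ler_piMl ?exprn_ile1 ?(ltW gap_gt0)//.
  - exact: ltW.
  - exact/ltW/gain_ratio_lt1.
have boundQ k : gagliardo_nirenberg_bound (Q k).
  elim: k => [|k IHk]; first exact: gagliardo_nirenberg_bound_base.
  exact: gagliardo_nirenberg_bound_gain.
suff [k Qk_gt_r] : exists k, r < Q k.
  exact: gagliardo_nirenberg_bound_interpolation (boundQ k).
have sigma_cvg0 : sigma ^+ k @[k --> \oo] --> 0.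
  by apply: cvg_expr; rewrite gtr0_norm// gain_ratio_lt1.
have ratio_gt0 : 0 < sobolev_gap r / sobolev_gap q by rewrite divr_gt0.
move/cvgrPdist_lt : sigma_cvg0 => /(_ _ ratio_gt0)[k _ /(_ k (leqnn k))] /=.
rewrite sub0r normrN ger0_norm ?exprn_ge0 ?(ltW sigma_gt0)// ltr_pdivlMr// -gapQ.
by rewrite ltr_sobolev_gap; exists k.
Qed.

Lemma gagliardo_nirenberg_pow r : q < r -> 0 < sobolev_gap r ->
  exists2 C : R, 0 < C & forall u, measurable_Rd u ->
    (0 < Lp_pow q u)%E -> (Lp_pow q u < +oo)%E ->
    (Lp_pow r u <= C%:E * (gagliardo_pow s p u `^ gagliardo_exponent r *
                           Lp_pow q u `^ base_exponent r))%E.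
Proof.
move=> qr r_subcritical.
have [C C_gt0 C_bound] := gagliardo_nirenberg_bound_subcritical qr r_subcritical.
exists C => // u mu; case uA: (Lp_pow q u) => [A| |]// A_gt0 _.
have := gagliardo_pow_ge0 s p u; case uG: (gagliardo_pow s p u) => [G| |]// G_ge0.
  by rewrite !poweR_EFin -!EFinM; apply: C_bound; rewrite ?uA ?uG.
rewrite poweRyr; last by rewrite gt_eqF// divr_gt0// mulr_gt0// subr_gt0.
by rewrite gt0_mulye ?poweR_gt0// gt0_muley ?leey.
Qed.

Lemma gagliardo_nirenberg r : q < r -> 0 < sobolev_gap r ->
  let theta := p * d%:R * (r - q) / (r * sobolev_gap q) in
  exists2 C : R, 0 < C & forall u, measurable_Rd u ->
    (0 < Lp_pow q u)%E -> (Lp_pow q u < +oo)%E ->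
    (Lp_norm r u <= C%:E * (gagliardo s p u `^ theta * Lp_norm q u `^ (1 - theta)))%E.
Proof.
move=> qr r_subcritical theta.
have [C C_gt0 C_bound] := gagliardo_nirenberg_pow qr r_subcritical.
have r_gt0 : 0 < r by exact: lt_trans qr.
exists (C `^ r^-1); first by rewrite powR_gt0.
move=> u mu uq_gt0 uq_fin; rewrite /Lp_norm /gagliardo -!poweRrM.
have [p_neq0 q_neq0 r_neq0] : [/\ p != 0, q != 0 & r != 0] by split; rewrite gt_eqF.
have -> : p^-1 * theta = gagliardo_exponent r * r^-1.
  by rewrite /theta /gagliardo_exponent; field; rewrite gap_neq0 r_neq0.
have -> : q^-1 * (1 - theta) = base_exponent r * r^-1.
  have := gap_neq0; rewrite /theta /base_exponent /sobolev_gap.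
  by move=> gap_unfolded_neq0; field; rewrite gap_unfolded_neq0 q_neq0 r_neq0.
rewrite (poweRrM _ _ r^-1) [(_ `^ (base_exponent r * _))%E]poweRrM.
rewrite -poweRM ?poweR_ge0// -poweR_EFin -poweRM ?lee_fin ?(ltW C_gt0)//.
- apply: gt0_ler_poweR; rewrite ?invr_ge0 ?(ltW r_gt0) ?in_itv/= ?leey ?andbT//.
  + exact: Lp_pow_ge0.
  + by rewrite mule_ge0 ?lee_fin ?(ltW C_gt0)// mule_ge0 ?poweR_ge0.
  + exact: C_bound.
- by rewrite mule_ge0 ?poweR_ge0.
Qed.
End BaseExponent.
End GagliardoNirenberg.

(** * A smooth bump function *)

Section Lipschitz.
Variable R : realType.

Lemma is_derive1_differentiable (f : R -> R) (x df : R) :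
  is_derive x 1 f df -> differentiable f x.
Proof. by move=> [f_derivable _]; exact/derivable1_diffP. Qed.

Lemma bounded_derivative_lipschitz (f df : R -> R) (k : R) :
  (forall x : R, is_derive x 1 f (df x)) -> (forall x, `|df x| <= k) ->
  forall x y, `|f x - f y| <= k * `|x - y|.
Proof.
move=> f_df df_le x y; wlog xy : x y / x <= y => [wlog_le|].
  by have [/wlog_le//|/ltW/wlog_le] := leP x y; rewrite distrC [`|y - x|]distrC.
have f_cont : {within `[x, y], continuous f}.
  apply: continuous_subspaceT => z; apply: differentiable_continuous.
  exact: is_derive1_differentiable (f_df z).
have [z _ fE] := MVT_segment xy (fun z _ => f_df z) f_cont.
by rewrite distrC fE [`|x - y|]distrC normrM ler_wpM2r.
Qed.

Lemma dist_prod_le (I : Type) (r : seq I) (f g : I -> R) :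
  (forall i, 0 <= f i <= 1) -> (forall i, 0 <= g i <= 1) ->
  `|\prod_(i <- r) f i - \prod_(i <- r) g i| <= \sum_(i <- r) `|f i - g i|.
Proof.
move=> f01 g01; elim: r => [|i r IHr]; first by rewrite !big_nil subrr normr0.
rewrite !big_cons; set F := \prod_(j <- r) f j; set G := \prod_(j <- r) g j.
have -> : f i * F - g i * G = (f i - g i) * G + f i * (F - G) by ring.
apply: le_trans (ler_normD _ _) _; rewrite !normrM lerD//.
  have /andP[G_ge0 G_le1] : 0 <= G <= 1.
    by rewrite prodr_ge0 ?prodr_ile1// => j _; have /andP[] := g01 j.
  by rewrite ler_piMr// ger0_norm.
have /andP[fi_ge0 fi_le1] := f01 i.
by apply: le_trans IHr; rewrite ler_piMl// ger0_norm.
Qed.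
End Lipschitz.

Section FlatExponential.
Variable R : realType.
Implicit Types (k : nat) (t : R).

Definition flat_exp k t : R :=
  if 0 < t then t^-1 ^+ k * expR (- t^-1) else 0.

Lemma exprn_expRN_le k t : 0 <= t -> t ^+ k * expR (- t) <= k`!%:R.
Proof.
move=> t_ge0; rewrite expRN ler_pdivrMr ?expR_gt0//.
case: k => [|k]; first by rewrite expr0 mul1r (le_trans _ (expR_ge1Dx t))// lerDl.
rewrite mulrC -ler_pdivrMr ?ltr0n ?fact_gt0//.
by apply: le_trans (expR_ge1Dxn k t_ge0); rewrite lerDr.
Qed.

Lemma flat_exp_npos k t : t <= 0 -> flat_exp k t = 0.
Proof. by rewrite /flat_exp ltNge => ->. Qed.

Lemma flat_exp_ge0 k t : 0 <= flat_exp k t.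
Proof.
rewrite /flat_exp; case: ltP => // t_gt0.
by rewrite mulr_ge0 ?expR_ge0// exprn_ge0// invr_ge0 ltW.
Qed.

Lemma flat_exp_le_fact k t : flat_exp k t <= k`!%:R.
Proof.
rewrite /flat_exp; case: ltP => // t_gt0.
by rewrite exprn_expRN_le// invr_ge0 ltW.
Qed.

Lemma flat_expS k t : t * flat_exp k.+1 t = flat_exp k t.
Proof.
rewrite /flat_exp; case: ltP => [t_gt0|_]; last by rewrite mulr0.
by rewrite exprS !mulrA divff ?gt_eqF// mul1r.
Qed.

Lemma is_derive_invX_expRN k t : t != 0 ->
  is_derive t 1 (fun x => x^-1 ^+ k * expR (- x^-1))
    (t^-1 ^+ k.+2 * expR (- t^-1) - k%:R * (t^-1 ^+ k.+1 * expR (- t^-1))).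
Proof.
move=> t_neq0; have dV : is_derive t 1 (fun x : R => x^-1) (- t ^- 2).
  apply: (is_derive_eq (is_deriveV (f := id) t_neq0 (is_derive_id t 1))).
  by rewrite /GRing.scale/= mulr1.
have dE : is_derive t 1 (fun x : R => expR (- x^-1)) (expR (- t^-1) * t ^- 2).
  apply: (is_derive_eq (is_derive1_comp (is_derive_expR _) (is_deriveN dV))).
  by rewrite opprK.
have dX : is_derive t 1 (fun x : R => x^-1 ^+ k) (k%:R * t^-1 ^+ k.-1 * (- t ^- 2)).
  rewrite (_ : (fun x => _) = (fun x : R => x^-1) ^+ k).
    exact: (is_derive_eq (is_deriveX k dV)).
  by apply: funext => x; rewrite fctE.
apply: (is_derive_eq (is_deriveM dX dE)); rewrite /GRing.scale/=.
by case: k {dX} => [|k]; rewrite /= ?exprS; field.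
Qed.

Lemma is_derive_flat_exp_at0 k : is_derive (0 : R) 1 (flat_exp k) 0.
Proof.
have quotient_cvg0 :
    h^-1 *: ((flat_exp k \o shift 0) (h *: 1) - flat_exp k 0) @[h --> 0^'] --> (0 : R).
  apply/cvgrPdist_le => eps eps_gt0; near=> h.
  have h_neq0 : h != 0 by near: h; exact: nbhs_dnbhs_neq.
  rewrite /= addr0 /GRing.scale/= mulr1 (flat_exp_npos _ (lexx 0)) subr0.
  rewrite sub0r normrN -(flat_expS k) mulKf// -flat_expS normrM.
  rewrite [`|flat_exp _ _|]ger0_norm ?flat_exp_ge0//.
  apply: le_trans (ler_wpM2l _ (flat_exp_le_fact _ _)) _ => //.
  rewrite -ler_pdivlMr ?ltr0n ?fact_gt0// ltW//.
  by near: h; apply: dnbhs0_lt; rewrite divr_gt0// ltr0n fact_gt0.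
by split; [exact: cvgP quotient_cvg0|exact: cvg_lim quotient_cvg0].
Unshelve. all: by end_near.
Qed.

Lemma is_derive_flat_exp k t :
  is_derive t 1 (flat_exp k) (flat_exp k.+2 t - k%:R * flat_exp k.+1 t).
Proof.
have [t_lt0|t_gt0|->] := ltgtP t 0.
- rewrite !(flat_exp_npos _ (ltW t_lt0)) mulr0 subr0.
  apply: (@near_eq_is_derive _ _ _ (cst (0 : R))).
  near=> x; rewrite flat_exp_npos// ltW//.
  by near: x; exact: lt_nbhsl.
- rewrite /flat_exp t_gt0.
  apply: (near_eq_is_derive _ (is_derive_invX_expRN k _)); last by rewrite gt_eqF.
  near=> x; rewrite ifT//.
  by near: x; exact: lt_nbhsr.
- rewrite !(flat_exp_npos _ (lexx 0)) mulr0 subr0.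
  exact: is_derive_flat_exp_at0.
Unshelve. all: by end_near.
Qed.
End FlatExponential.

Section Bump1D.
Variable R : realType.
Implicit Type t : R.

Definition bump1 t : R := flat_exp 0 (1 - t ^+ 2).

Lemma bump1_itv t : 0 <= bump1 t <= 1.
Proof. by rewrite flat_exp_ge0 (flat_exp_le_fact 0). Qed.

Lemma bump1_eq0 t : 1 <= `|t| -> bump1 t = 0.
Proof.
move=> t_ge1; apply: flat_exp_npos; rewrite subr_le0 -real_normK ?num_real//.
exact: exprn_ege1.
Qed.

Lemma bump1_ge t : `|t| <= 2^-1 -> expR (- 2) <= bump1 t.
Proof.
move=> t_le; have arg_ge : 2^-1 <= 1 - t ^+ 2.
  have : t ^+ 2 <= 2^-1 ^+ 2 by rewrite -real_normK ?num_real// lerXn2r ?nnegrE.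
  by rewrite expr2; lra.
have arg_gt0 : 0 < 1 - t ^+ 2 by exact: lt_le_trans arg_ge.
rewrite /bump1 /flat_exp arg_gt0 mul1r ler_expR lerN2.
by rewrite -[leRHS]invrK lef_pV2 ?posrE.
Qed.

Lemma is_derive_bump1 t : is_derive t 1 bump1 (flat_exp 2 (1 - t ^+ 2) * - (2 * t)).
Proof.
have dsq : is_derive t 1 (fun t => 1 - t ^+ 2) (- (2 * t)).
  rewrite (_ : (fun t => _) = cst 1 - id ^+ 2); last by apply: funext => z; rewrite !fctE.
  by apply: is_derive_eq; rewrite sub0r /GRing.scale/= mulr1.
apply: (is_derive_eq (is_derive1_comp (is_derive_flat_exp 0 _) dsq)).
by rewrite mul0r subr0.
Qed.

Lemma bump1_lipschitz t t' : `|bump1 t - bump1 t'| <= 4 * `|t - t'|.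
Proof.
apply: bounded_derivative_lipschitz is_derive_bump1 _ t t' => t.
rewrite normrM normrN normrM ger0_norm ?flat_exp_ge0// [`|2|]ger0_norm//.
have [t_lt1|t_ge1] := ltP `|t| 1; last first.
  rewrite flat_exp_npos ?mul0r// subr_le0 -real_normK ?num_real//.
  exact: exprn_ege1.
rewrite (_ : 4 = 2 * (2 * 1)); last by ring.
apply: ler_pM; rewrite ?flat_exp_ge0 ?mulr_ge0//; first exact: (flat_exp_le_fact 2).
by rewrite ler_pM2l// ltW.
Qed.

Lemma measurable_bump1 : measurable_fun setT bump1.
Proof.
apply: continuous_measurable_fun => t; apply: differentiable_continuous.
exact: is_derive1_differentiable (is_derive_bump1 t).
Qed.
End Bump1D.

Section Bump.
Variables (R : realType) (d : nat).
Implicit Types x y : 'rV[R]_d.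

Definition bumpRd x : R := \prod_i bump1 (x ord0 i).

Lemma bumpRd_ge0 x : 0 <= bumpRd x.
Proof. by apply: prodr_ge0 => i _; have /andP[] := bump1_itv (x ord0 i). Qed.

Lemma bumpRd_le1 x : bumpRd x <= 1.
Proof. by apply: prodr_ile1 => i _; exact: bump1_itv. Qed.

Lemma bumpRd_eq0 x : 1 < `|x| -> bumpRd x = 0.
Proof.
rewrite ltNge => /(mx_norm_leP x ler01)/existsNP[i /negP]; rewrite -ltNge => /ltW xi_ge1.
by rewrite /bumpRd (bigD1 i)//= bump1_eq0 ?mul0r.
Qed.

Lemma bumpRd_ge x : `|x| <= 2^-1 -> expR (- 2) ^+ d <= bumpRd x.
Proof.
have half_ge0 : 0 <= 2^-1 :> R by [].
move=> /(mx_norm_leP x half_ge0) x_le; rewrite -[d]card_ord -prodr_const.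
by apply: ler_prod => i _; rewrite expR_ge0 bump1_ge// x_le.
Qed.

Lemma bumpRd_lipschitz x y : `|bumpRd x - bumpRd y| <= 4 * d%:R * `|x - y|.
Proof.
apply: le_trans (dist_prod_le _ _ _) _ => [i|i|]; [exact: bump1_itv..|].
have -> : 4 * d%:R * `|x - y| = \sum_(i < d) 4 * `|x - y|.
  by rewrite sumr_const card_ord mulrAC mulr_natr.
apply: ler_sum => i _; apply: le_trans (bump1_lipschitz _ _) _.
by rewrite ler_pM2l//; have := norm_coord_le (x - y) i; rewrite !mxE.
Qed.

Lemma measurable_bumpRd : measurable_Rd bumpRd.
Proof.
apply: measurable_prod => i _.
exact: measurableT_comp (@measurable_bump1 R) (measurable_rV_coord i).
Qed.

(* A class of smooth functions containing [bumpRd] and stable under directional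
   derivatives. *)
Inductive flat_exp_algebra : ('rV[R]_d -> R) -> Prop :=
| flat_exp_algebra_cst c : flat_exp_algebra (cst c)
| flat_exp_algebra_coord i : flat_exp_algebra (fun x => x ord0 i)
| flat_exp_algebraD f g :
    flat_exp_algebra f -> flat_exp_algebra g -> flat_exp_algebra (f + g)
| flat_exp_algebraM f g :
    flat_exp_algebra f -> flat_exp_algebra g -> flat_exp_algebra (f * g)
| flat_exp_algebra_comp k f :
    flat_exp_algebra f -> flat_exp_algebra (flat_exp k \o f).

Lemma derive_coord i x v : 'D_v (fun x : 'rV[R]_d => x ord0 i) x = v ord0 i.
Proof.
apply/cvg_lim => //; apply: cvg_near_cst; near=> h.
rewrite /= !mxE addrK scalerA mulVf ?scale1r//.
by near: h; exact: nbhs_dnbhs_neq.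
Unshelve. all: by end_near.
Qed.

Lemma differentiable_flat_exp k (t : R) : differentiable (flat_exp k) t.
Proof. exact: is_derive1_differentiable (is_derive_flat_exp k t). Qed.

Lemma derive_flat_exp_comp k f x v : differentiable f x ->
  'D_v (flat_exp k \o f) x =
  'D_v f x * (flat_exp k.+2 (f x) + - k%:R * flat_exp k.+1 (f x)).
Proof.
move=> df; have dflat := differentiable_flat_exp k (f x).
have dcomp : differentiable (flat_exp k \o f) x by exact: differentiable_comp.
rewrite deriveE// diff_comp// [LHS]/= diff1E// derive1E.
by rewrite (@derive_val _ _ _ _ _ _ _ (is_derive_flat_exp k (f x))) -deriveE// mulNr.
Qed.

Lemma flat_exp_algebra_derive f : flat_exp_algebra f ->
  (forall x, differentiable f x) /\ (forall v, flat_exp_algebra ('D_v f)).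
Proof.
elim=> {f} [c|i|f g _ [df Df] _ [dg Dg]|f g mf [df Df] mg [dg Dg]|k f mf [df Df]].
- split=> [x|v]; first exact: differentiable_cst.
  rewrite (_ : 'D_v _ = cst 0); first exact: flat_exp_algebra_cst.
  by apply: funext => x; rewrite derive_cst.
- split=> [x|v]; first exact: differentiable_coord.
  rewrite (_ : 'D_v _ = cst (v ord0 i)); first exact: flat_exp_algebra_cst.
  by apply: funext => x; exact: derive_coord.
- split=> [x|v]; first exact: differentiableD.
  rewrite (_ : 'D_v _ = 'D_v f + 'D_v g); first exact: flat_exp_algebraD.
  by apply: funext => x; rewrite deriveD//; exact: diff_derivable.
- split=> [x|v]; first exact: differentiableM.
  rewrite (_ : 'D_v _ = f * 'D_v g + g * 'D_v f).
    by apply: flat_exp_algebraD; exact: flat_exp_algebraM.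
  by apply: funext => x; rewrite deriveM//; exact: diff_derivable.
- split=> [x|v]; first exact: differentiable_comp (df x) (differentiable_flat_exp _ _).
  rewrite (_ : 'D_v _ =
    'D_v f * ((flat_exp k.+2 \o f) + cst (- k%:R) * (flat_exp k.+1 \o f))).
    apply: flat_exp_algebraM => //; apply: flat_exp_algebraD.
      exact: flat_exp_algebra_comp.
    apply: flat_exp_algebraM; first exact: flat_exp_algebra_cst.
    exact: flat_exp_algebra_comp.
  by apply: funext => x; rewrite derive_flat_exp_comp.
Qed.

Lemma flat_exp_algebra_bumpRd : flat_exp_algebra bumpRd.
Proof.
rewrite (_ : bumpRd = \prod_i (flat_exp 0 \o
  (cst 1 + cst (-1) * ((fun x => x ord0 i) * (fun x => x ord0 i))))); last first.
  apply: funext => x; rewrite fct_prodE; apply: eq_bigr => i _.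
  by rewrite /bump1 /= !fctE mulN1r expr2.
elim/big_ind: _ => [|f g|i _]; [exact: flat_exp_algebra_cst|exact: flat_exp_algebraM|].
apply/flat_exp_algebra_comp/flat_exp_algebraD; first exact: flat_exp_algebra_cst.
apply: flat_exp_algebraM; first exact: flat_exp_algebra_cst.
by apply: flat_exp_algebraM; exact: flat_exp_algebra_coord.
Qed.

Lemma smooth_bumpRd : smooth bumpRd.
Proof.
move=> vs; suff : flat_exp_algebra (iter_derive vs bumpRd).
  by case/flat_exp_algebra_derive.
elim: vs => [|v vs IHvs]; first exact: flat_exp_algebra_bumpRd.
exact: (flat_exp_algebra_derive IHvs).2.
Qed.

Lemma Cc_infty_bumpRd : Cc_infty bumpRd.
Proof.
split; first exact: smooth_bumpRd.
have support_sub : closure [set x | bumpRd x != 0] `<=` [set x | `|x| <= 1].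
  rewrite [X in _ `<=` X](closure_id _).1; last first.
    by apply: closed_comp (@closed_le _ 1) => x _; exact: norm_continuous.
  apply: closure_subset => x /=; apply: contra_neqT => /=.
  by rewrite -ltNge; exact: bumpRd_eq0.
apply: bounded_closed_compact; last exact: closed_closure.
by exists 1; split=> // M M_gt1 x /support_sub/le_trans; apply; exact: ltW.
Qed.
End Bump.

(** * Finite energy of Lipschitz functions with bounded support *)

Section Series.
Variable R : realType.

Lemma exists_pow2_bounds (t : R) : 1 <= t -> exists k, 2 ^+ k <= t < 2 ^+ k.+1.
Proof.
move=> t_ge1; have t_ge0 : 0 <= t by exact: le_trans t_ge1.
have /andP[trunc_le lt_truncS] := truncn_itv t_ge0.
have trunc_gt0 : (0 < Num.truncn t)%N.
  by rewrite -ltnS -(ltr_nat R); exact: le_lt_trans lt_truncS.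
have /andP[pow_le lt_pow] := trunc_log_bounds (isT : (1 < 2)%N) trunc_gt0.
exists (trunc_log 2 (Num.truncn t)); apply/andP; split.
  by apply: le_trans trunc_le; rewrite -natrX ler_nat.
by apply: lt_le_trans lt_truncS _; rewrite -natrX ler_nat.
Qed.

Lemma nneseries_geometric_le (a z : R) : 0 <= a -> 0 < z -> z < 1 ->
  (\sum_(k <oo) (a * z ^+ k)%:E <= (a / (1 - z))%:E)%E.
Proof.
move=> a_ge0 z_gt0 z_lt1; apply: lime_le.
  apply: is_cvg_nneseries => k _ _.
  by rewrite lee_fin mulr_ge0// exprn_ge0// ltW.
apply: nearW => n; rewrite sumEFin lee_fin; apply: geometric_le_lim => //.
by rewrite gtr0_norm.
Qed.

Lemma le_nneseries_term (f : nat -> \bar R) k : (forall n, 0 <= f n)%E ->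
  (f k <= \sum_(n <oo) f n)%E.
Proof.
move=> f_ge0; apply: le_trans (nneseries_lim_ge k.+1 _) => //.
by rewrite big_nat_recr//= leeDr// sume_ge0.
Qed.
End Series.

Section CubeSeries.
Variables (R : realType) (d : nat).
Implicit Types (c x : 'rV[R]_d) (a rho z w b : R).

(* With [z] and [w] powers of two, a dyadic majorant of a power of [`|x - c|] whose
   integral is a geometric series. *)
Definition cube_series c a rho z w x : \bar R :=
  (\sum_(k <oo) (a * z ^+ k)%:E * cube_ind c (rho * w ^+ k) x)%E.

Section Bounds.
Variables a rho z w : R.
Hypotheses (a_ge0 : 0 <= a) (rho_ge0 : 0 <= rho) (z_gt0 : 0 < z) (w_gt0 : 0 < w).

Let az_ge0 k : 0 <= a * z ^+ k.
Proof. by rewrite mulr_ge0// exprn_ge0// ltW. Qed.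

Let rhow_ge0 k : 0 <= rho * w ^+ k.
Proof. by rewrite mulr_ge0// exprn_ge0// ltW. Qed.

Let cube_term_ge0 c k x : (0 <= (a * z ^+ k)%:E * cube_ind c (rho * w ^+ k) x)%E.
Proof. by rewrite mule_ge0 ?cube_ind_ge0// lee_fin. Qed.

Lemma le_cube_series c x k : `|x - c| <= rho * w ^+ k ->
  ((a * z ^+ k)%:E <= cube_series c a rho z w x)%E.
Proof.
move=> x_near; apply: le_trans (le_nneseries_term k (cube_term_ge0 c ^~ x)).
by rewrite /cube_ind x_near mule1.
Qed.

Lemma cube_series_ge0 c x : (0 <= cube_series c a rho z w x)%E.
Proof. by apply: nneseries_ge0 => k _ _; exact: cube_term_ge0. Qed.

Lemma emeasurable_cube_series c : emeasurable_Rd (cube_series c a rho z w).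
Proof.
apply: (@ge0_emeasurable_sum _ _ _ _ (fun k t => (a * z ^+ k)%:E *
  cube_ind c (rho * w ^+ k) (rV_of_tuple t))%E xpredT) => [k t _ _|k _].
- exact: cube_term_ge0.
- exact: (emeasurable_RdZ _ (emeasurable_cube_ind c (rhow_ge0 k))).
Qed.

Lemma intRd_cube_series_le c : z * w ^+ d < 1 ->
  (intRd (cube_series c a rho z w) <=
   (a * (2 * rho) ^+ d / (1 - z * w ^+ d))%:E)%E.
Proof.
move=> ratio_lt1; rewrite intRd_nneseries//; last first.
  by move=> k; exact: (emeasurable_RdZ _ (emeasurable_cube_ind c (rhow_ge0 k))).
have ratio_gt0 : 0 < z * w ^+ d by rewrite mulr_gt0 ?exprn_gt0.
have amp_ge0 : 0 <= a * (2 * rho) ^+ d by rewrite mulr_ge0 ?exprn_ge0 ?mulr_ge0.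
apply: le_trans (nneseries_geometric_le amp_ge0 ratio_gt0 ratio_lt1).
rewrite le_eqVlt; apply/predU1P; left; apply: eq_eseriesr => k _.
rewrite intRdZ//; [|exact: cube_ind_ge0|exact: emeasurable_cube_ind].
rewrite intRd_cube// -EFinM; congr EFin.
by rewrite !exprMn -[w ^+ k ^+ d]exprM mulnC exprM; ring.
Qed.
End Bounds.

Lemma powR_norm_le_near_series c b x : 0 < `|x - c| <= 1 ->
  ((`|x - c| `^ b)%:E <= cube_series c (2 `^ `|b|) 1 (2 `^ (- b)) 2^-1 x)%E.
Proof.
move=> /andP[dist_gt0 dist_le1].
have [k /andP[pow_le lt_pow]] : exists k, 2 ^+ k <= `|x - c|^-1 < 2 ^+ k.+1.
  by apply: exists_pow2_bounds; rewrite invf_ge1.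
have pow_gt0 n : 0 < 2 ^+ n :> R by rewrite exprn_gt0.
have dist_le : `|x - c| <= 2^-1 ^+ k.
  by rewrite exprVn -[leLHS]invrK lef_pV2 ?posrE ?invr_gt0.
apply: (@le_trans _ _ (2 `^ `|b| * (2 `^ (- b)) ^+ k)%:E); last first.
  by apply: le_cube_series; rewrite ?mul1r ?powR_ge0 ?powR_gt0.
rewrite lee_fin powR_exprn//.
have -> : `|x - c| `^ b = `|x - c|^-1 `^ (- b).
  by rewrite -powR_inv1// -powRrM mulN1r opprK.
have [b_ge0|b_lt0] := leP 0 b.
  apply: (@le_trans _ _ ((2 ^+ k) `^ (- b))).
    rewrite !powRN lef_pV2 ?posrE ?powR_gt0 ?invr_gt0//.
    by rewrite ge0_ler_powR ?nnegrE ?invr_ge0// ltW.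
  by rewrite ler_peMl ?powR_ge0// powR_ge1 ?ler1n.
rewrite ltr0_norm// -powRM ?(ltW (pow_gt0 _))// -exprS.
by rewrite ge0_ler_powR ?nnegrE ?oppr_ge0 ?invr_ge0 ?(ltW b_lt0)// ltW.
Qed.

Lemma powR_norm_le_far_series c b x : b <= 0 -> 1 <= `|x - c| ->
  ((`|x - c| `^ b)%:E <= cube_series c 1 2 (2 `^ b) 2 x)%E.
Proof.
move=> b_le0 dist_ge1.
have [k /andP[pow_le lt_pow]] := exists_pow2_bounds dist_ge1.
have pow_gt0 : 0 < 2 ^+ k :> R by rewrite exprn_gt0.
apply: (@le_trans _ _ (1 * (2 `^ b) ^+ k)%:E); last first.
  by apply: le_cube_series; rewrite ?powR_gt0// -exprS ltW.
rewrite lee_fin mul1r powR_exprn// -[b]opprK ![_ `^ (- - b)]powRN.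
rewrite lef_pV2 ?posrE ?powR_gt0//; last exact: lt_le_trans pow_gt0 pow_le.
by rewrite ge0_ler_powR ?nnegrE ?oppr_ge0// ltW.
Qed.

Lemma near_series_ratio_lt1 b : - d%:R < b -> 2 `^ (- b) * 2^-1 ^+ d < 1 :> R.
Proof.
move=> b_gt; rewrite exprVn -powR_mulrn// -powRN -powRD ?pnatr_eq0 ?implybT//.
by apply: powR_lt1; [rewrite ltr1n|lra].
Qed.

Lemma far_series_ratio_lt1 b : b < - d%:R -> 2 `^ b * 2 ^+ d < 1 :> R.
Proof.
move=> b_lt; rewrite -powR_mulrn// -powRD ?pnatr_eq0 ?implybT//.
by apply: powR_lt1; [rewrite ltr1n|lra].
Qed.
End CubeSeries.

Section FiniteEnergy.
Variables (R : realType) (d : nat).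
Implicit Types (u : 'rV[R]_d -> R) (x y : 'rV[R]_d).

Lemma Lp_pow_lty u (e M rho : R) : 0 < e -> 0 <= rho ->
  (forall x, `|u x| <= M) -> (forall x, rho < `|x| -> u x = 0) ->
  (Lp_pow e u < +oo)%E.
Proof.
move=> e_gt0 rho_ge0 u_le u_support.
apply: (@le_lt_trans _ _ (intRd (fun x => (M `^ e)%:E * cube_ind 0 rho x)%E)).
  apply: le_intRd => x; first by rewrite lee_fin powR_ge0.
  rewrite /cube_ind subr0; have [x_le|/u_support->] := leP `|x| rho.
    by rewrite mule1 lee_fin ge0_ler_powR ?nnegrE ?(le_trans _ (u_le x))// ltW.
  by rewrite normr0 powR0 ?mule0// gt_eqF.
rewrite intRdZ ?powR_ge0//; first by rewrite intRd_cube// -EFinM ltry.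
- exact: cube_ind_ge0.
- exact: emeasurable_cube_ind.
Qed.

Lemma Lp_pow_gt0 u (e c rho : R) : 0 < e -> 0 < c -> 0 < rho ->
  (forall x, `|x| <= rho -> c <= u x) -> (0 < Lp_pow e u)%E.
Proof.
move=> e_gt0 c_gt0 rho_gt0 u_ge.
apply: (@lt_le_trans _ _ (intRd (fun x => (c `^ e)%:E * cube_ind 0 rho x)%E)).
  rewrite intRdZ ?powR_ge0//; last 2 first.
  - exact: cube_ind_ge0.
  - exact: (emeasurable_cube_ind 0 (ltW rho_gt0)).
  rewrite intRd_cube ?(ltW rho_gt0)// -EFinM lte_fin mulr_gt0 ?powR_gt0//.
  by rewrite exprn_gt0 ?mulr_gt0.
apply: le_intRd => x; first by rewrite mule_ge0 ?cube_ind_ge0 ?lee_fin ?powR_ge0.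
rewrite /cube_ind subr0; have [/u_ge ux_ge|_] := leP `|x| rho; last first.
  by rewrite mule0 lee_fin powR_ge0.
rewrite mule1 lee_fin ge0_ler_powR ?nnegrE ?(ltW e_gt0) ?(ltW c_gt0)//.
exact: le_trans (ler_norm _).
Qed.

Variables s p : R.
Hypotheses (s_gt0 : 0 < s) (s_lt1 : s < 1) (p_gt0 : 0 < p).

Let beta : R := d%:R + s * p.
Let beta_gt_d : d%:R < beta. Proof. by rewrite ltrDl mulr_gt0. Qed.
Let beta_gt0 : 0 < beta. Proof. exact: le_lt_trans beta_gt_d. Qed.

Lemma gkernel_diag u y : gkernel s p u y y = 0%E.
Proof. by rewrite /gkernel subrr normr0 powR0 ?mul0r// gt_eqF. Qed.

Lemma gkernel_le_powR_norm u (D : R) y x : x != y -> `|u x - u y| <= D ->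
  (gkernel s p u y x <= (D `^ p * `|x - y| `^ (- beta))%:E)%E.
Proof.
move=> xy uD; have D_ge0 : 0 <= D by exact: le_trans uD.
have dist_gt0 : 0 < `|x - y| by rewrite normr_gt0 subr_eq0.
have edist_gt0 := lt_le_trans dist_gt0 (norm_le_enorm (x - y)).
rewrite lee_fin powRN ler_pM ?invr_ge0 ?powR_ge0//.
  by rewrite ge0_ler_powR ?nnegrE// ltW.
rewrite lef_pV2 ?posrE ?powR_gt0// ge0_ler_powR ?nnegrE ?enorm_ge0 ?(ltW beta_gt0)//.
exact: norm_le_enorm.
Qed.

Section LipschitzSupported.
Variables (u : 'rV[R]_d -> R) (L M rho : R).
Hypotheses (L_ge0 : 0 <= L) (rho_ge0 : 0 <= rho).
Hypothesis u_lipschitz : forall x y, `|u x - u y| <= L * `|x - y|.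
Hypothesis u_le : forall x, `|u x| <= M.
Hypothesis u_support : forall x, rho < `|x| -> u x = 0.

Let near_series y := cube_series y (2 `^ `|p - beta|) 1 (2 `^ (- (p - beta))) 2^-1.
Let far_series y := cube_series y 1 2 (2 `^ (- beta)) 2.

Let near_ratio_lt1 : 2 `^ (- (p - beta)) * 2^-1 ^+ d < 1 :> R.
Proof.
apply: near_series_ratio_lt1; rewrite /beta.
by have : s * p < p by [rewrite gtr_pMl]; lra.
Qed.

Let far_ratio_lt1 : 2 `^ (- beta) * 2 ^+ d < 1 :> R.
Proof. by apply: far_series_ratio_lt1; rewrite ltrN2. Qed.

Lemma gkernel_le_cube_series y x :
  (gkernel s p u y x <=
   (L `^ p)%:E * near_series y x + ((2 * M) `^ p)%:E * far_series y x)%E.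
Proof.
have near_ge0 : (0 <= (L `^ p)%:E * near_series y x)%E.
  by rewrite mule_ge0 ?lee_fin ?powR_ge0// cube_series_ge0 ?powR_ge0 ?powR_gt0.
have far_ge0 : (0 <= ((2 * M) `^ p)%:E * far_series y x)%E.
  by rewrite mule_ge0 ?lee_fin ?powR_ge0// cube_series_ge0 ?powR_gt0.
have [xy|xy] := eqVneq x y.
  by apply: le_trans (adde_ge0 near_ge0 far_ge0); rewrite xy gkernel_diag.
have dist_gt0 : 0 < `|x - y| by rewrite normr_gt0 subr_eq0.
have [dist_le1|/ltW dist_ge1] := leP `|x - y| 1.
  apply: le_trans (gkernel_le_powR_norm xy (u_lipschitz x y)) _.
  rewrite powRM ?(ltW dist_gt0)// -mulrA -powRD ?(gt_eqF dist_gt0) ?implybT// EFinM.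
  apply: le_trans (leeDl _ far_ge0); rewrite lee_wpmul2l ?lee_fin ?powR_ge0//.
  by apply: powR_norm_le_near_series; rewrite dist_gt0.
have u_diff : `|u x - u y| <= 2 * M.
  apply: le_trans (ler_normB _ _) _; rewrite mulr2n mulrDl !mul1r.
  exact: lerD.
apply: le_trans (gkernel_le_powR_norm xy u_diff) _; rewrite EFinM.
apply: le_trans (leeDr _ near_ge0); rewrite lee_wpmul2l ?lee_fin ?powR_ge0//.
by apply: powR_norm_le_far_series; rewrite // oppr_le0 ltW.
Qed.

Lemma gdensity_bounded :
  exists2 B : R, 0 <= B & forall y, (gdensity s p u y <= B%:E)%E.
Proof.
pose near_bound := 2 `^ `|p - beta| * (2 * 1) ^+ d /
  (1 - 2 `^ (- (p - beta)) * 2^-1 ^+ d).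
pose far_bound : R := 1 * (2 * 2) ^+ d / (1 - 2 `^ (- beta) * 2 ^+ d).
have near_bound_ge0 : 0 <= near_bound.
  by rewrite divr_ge0 ?mulr_ge0 ?powR_ge0 ?exprn_ge0// subr_ge0 ltW.
have far_bound_ge0 : 0 <= far_bound.
  by rewrite divr_ge0 ?mulr_ge0 ?exprn_ge0// subr_ge0 ltW.
exists (L `^ p * near_bound + (2 * M) `^ p * far_bound).
  by apply: addr_ge0; apply: mulr_ge0 => //; exact: powR_ge0.
move=> y; apply: le_trans (le_intRd (gkernel_ge0 s p u y) (gkernel_le_cube_series y)) _.
have near_ge0 x : (0 <= near_series y x)%E.
  by rewrite cube_series_ge0 ?powR_ge0 ?powR_gt0.
have far_ge0 x : (0 <= far_series y x)%E by rewrite cube_series_ge0 ?powR_gt0.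
have mnear : emeasurable_Rd (near_series y).
  by apply: emeasurable_cube_series; rewrite ?powR_ge0 ?powR_gt0.
have mfar : emeasurable_Rd (far_series y).
  by apply: emeasurable_cube_series; rewrite ?powR_gt0.
rewrite intRdD ?intRdZ ?powR_ge0//; last 4 first.
- by move=> x; rewrite mule_ge0// lee_fin powR_ge0.
- by move=> x; rewrite mule_ge0// lee_fin powR_ge0.
- exact: emeasurable_RdZ.
- exact: emeasurable_RdZ.
rewrite EFinD !EFinM leeD// lee_wpmul2l ?lee_fin ?powR_ge0//.
- by apply: intRd_cube_series_le; rewrite ?powR_ge0 ?powR_gt0.
- by apply: intRd_cube_series_le; rewrite ?powR_gt0.
Qed.

Lemma gdensity_le_far y : 2 * rho < `|y| ->
  (gdensity s p u y <=
   (M `^ p * (2 * rho) ^+ d * 2 `^ beta)%:E * (`|y| `^ (- beta))%:E)%E.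
Proof.
move=> y_far; have rho_lt_y : rho < `|y| by move: rho_ge0 y_far; lra.
have y_gt0 : 0 < `|y| by exact: le_lt_trans rho_lt_y.
have uy0 : u y = 0 by exact: u_support.
pose c := M `^ p * (`|y| / 2) `^ (- beta).
have c_split : c = M `^ p * 2 `^ beta * `|y| `^ (- beta).
  by rewrite /c powRM ?invr_ge0// -powR_inv1// -powRrM mulrNN mul1r; ring.
have c_ge0 : 0 <= c by rewrite mulr_ge0 ?powR_ge0.
apply: (@le_trans _ _ (intRd (fun x => c%:E * cube_ind 0 rho x)%E)); last first.
  rewrite intRdZ//; last 2 first.
  - exact: cube_ind_ge0.
  - exact: emeasurable_cube_ind.
  rewrite intRd_cube// -!EFinM lee_fin c_split le_eqVlt; apply/predU1P; left; ring.
apply: le_intRd => x; first exact: gkernel_ge0.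
rewrite /cube_ind subr0; have [x_le|/u_support ux0] := leP `|x| rho; last first.
  by rewrite /gkernel ux0 uy0 subrr normr0 powR0 ?gt_eqF// mul0r mule0.
have dist_ge : `|y| / 2 <= `|x - y|.
  by have := lerB_dist y x; rewrite distrC; lra.
have dist_gt0 : 0 < `|x - y| by apply: lt_le_trans dist_ge; rewrite divr_gt0.
have u_diff : `|u x - u y| <= M by rewrite uy0 subr0.
rewrite mule1; apply: le_trans (gkernel_le_powR_norm _ u_diff) _.
  by rewrite -subr_eq0 -normr_gt0.
rewrite lee_fin ler_wpM2l ?powR_ge0// !powRN lef_pV2 ?posrE ?powR_gt0 ?divr_gt0//.
by rewrite ge0_ler_powR ?nnegrE ?(ltW beta_gt0) ?divr_ge0.
Qed.

Lemma gagliardo_pow_lty : (gagliardo_pow s p u < +oo)%E.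
Proof.
have [B B_ge0 gdensity_le] := gdensity_bounded.
pose K := M `^ p * (2 * rho) ^+ d * 2 `^ beta.
have K_ge0 : 0 <= K by rewrite !mulr_ge0 ?powR_ge0 ?exprn_ge0 ?mulr_ge0.
pose radius := 2 * rho + 1.
have radius_ge0 : 0 <= radius by rewrite addr_ge0 ?mulr_ge0.
have far_ge0 y : (0 <= far_series 0 y)%E by rewrite cube_series_ge0 ?powR_gt0.
have mfar : emeasurable_Rd (far_series 0).
  by apply: emeasurable_cube_series; rewrite ?powR_gt0.
apply: (@le_lt_trans _ _
    (intRd (fun y => B%:E * cube_ind 0 radius y + K%:E * far_series 0 y)%E)).
  apply: le_intRd => y; first exact: gdensity_ge0.
  rewrite /cube_ind subr0; have [y_near|y_far] := leP `|y| radius.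
    by rewrite mule1; apply: le_trans (gdensity_le y) _; rewrite leeDl ?mule_ge0.
  rewrite mule0 add0e; apply: le_trans (gdensity_le_far _) _.
    by apply: lt_trans y_far; rewrite ltrDl.
  rewrite lee_wpmul2l ?lee_fin// -[y in `|y|]subr0.
  apply: powR_norm_le_far_series; first by rewrite oppr_le0 ltW.
  by rewrite subr0; apply: le_trans (ltW y_far); rewrite lerDr mulr_ge0.
rewrite intRdD; last 4 first.
- by move=> y; rewrite mule_ge0 ?cube_ind_ge0.
- by move=> y; rewrite mule_ge0 ?lee_fin.
- exact: (emeasurable_RdZ B (emeasurable_cube_ind 0 radius_ge0)).
- exact: emeasurable_RdZ.
rewrite !intRdZ//; [|exact: cube_ind_ge0|exact: emeasurable_cube_ind].
rewrite lte_add_pinfty// ?intRd_cube -?EFinM ?ltry//.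
rewrite lte_mul_pinfty ?lee_fin//.
by apply: le_lt_trans (intRd_cube_series_le _ _ _ _ _ far_ratio_lt1) (ltry _).
Qed.
End LipschitzSupported.
End FiniteEnergy.

(** * The optimal constant *)

Section OptimalConstant.
Variables (R : realType) (U : Type) (D : set U) (N K : U -> \bar R).
Hypotheses (N_ge0 : forall u, (0 <= N u)%E) (K_ge0 : forall u, (0 <= K u)%E).

Definition admissible_constants : set R :=
  [set L | forall u, D u -> (N u <= L%:E * K u)%E].

Lemma le_inf_admissible_constants u : admissible_constants !=set0 ->
  D u -> (K u < +oo)%E -> (N u <= (inf admissible_constants)%:E * K u)%E.
Proof.
move=> [L L_adm] Du; have := L_adm _ Du; move: (K_ge0 u) (N_ge0 u).
case KuE: (K u) => [k| |]//; case NuE: (N u) => [n| |]//; rewrite -!EFinM !lee_fin.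
rewrite le_eqVlt => /predU1P[<-|k_gt0] _ Nu_le _; first by rewrite !mulr0 in Nu_le *.
rewrite -ler_pdivrMr//; apply: lb_le_inf; first by exists L.
by move=> L' /(_ _ Du); rewrite NuE KuE -EFinM lee_fin ler_pdivrMr.
Qed.

Lemma constant_gt0 (L : R) u : (0 < N u)%E -> (N u <= L%:E * K u)%E -> 0 < L.
Proof.
move=> Nu_gt0 Nu_le; rewrite ltNge; apply/negP => L_le0.
have := lt_le_trans Nu_gt0 Nu_le.
by rewrite ltNge mule_le0_ge0 ?lee_fin.
Qed.

(* Where [K u = +oo] every positive constant works, so it is enough that [K] be
   finite at one test element [u0]. *)
Lemma exists_optimal_constant (u0 : U) :
  admissible_constants !=set0 -> D u0 -> (0 < N u0)%E -> (K u0 < +oo)%E ->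
  exists L : R, [/\ 0 < L, admissible_constants L & lbound admissible_constants L].
Proof.
move=> adm_neq0 Du0 Nu0_gt0 Ku0_lty; pose L := inf admissible_constants.
have L_gt0 : 0 < L.
  exact: constant_gt0 Nu0_gt0 (le_inf_admissible_constants adm_neq0 Du0 Ku0_lty).
exists L; split=> // [u Du|L' L'_adm]; last first.
  apply: ge_inf => //; exists 0 => L'' /(_ _ Du0) Nu0_le.
  exact/ltW/(constant_gt0 Nu0_gt0 Nu0_le).
have [Ku_lty|] := ltP (K u) +oo%E; first exact: le_inf_admissible_constants.
by rewrite leye_eq => /eqP ->; rewrite gt0_muley ?leey ?lte_fin.
Qed.
End OptimalConstant.

Section AdmissibleFunctions.
Variables (R : realType) (d : nat).

Definition gagliardo_nirenberg_rhs (s p q a : R) (u : 'rV[R]_d -> R) : \bar R :=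
  (gagliardo s p u `^ a * Lp_norm q u `^ (1 - a))%E.

Lemma gagliardo_nirenberg_rhs_ge0 s p q a u :
  (0 <= gagliardo_nirenberg_rhs s p q a u)%E.
Proof. by rewrite mule_ge0 ?poweR_ge0. Qed.

Lemma gagliardo_nirenberg_rhs_lty s p q a u :
  (gagliardo_pow s p u < +oo)%E -> (Lp_pow q u < +oo)%E ->
  (gagliardo_nirenberg_rhs s p q a u < +oo)%E.
Proof.
move=> energy_lty Lq_lty; apply: lte_mul_pinfty; rewrite ?poweR_ge0 ?poweR_lty//.
by rewrite ge0_fin_numE ?poweR_ge0 ?poweR_lty.
Qed.

Lemma in_Dpqs_Lp_pow_gt0 s p q (u : 'rV[R]_d -> R) : p != 0 -> q != 0 ->
  in_Dpqs s p q u -> (0 < Lp_pow q u)%E.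
Proof.
move=> p_neq0 q_neq0 [_ [[mu _]]]; apply: contraTT; rewrite -!leNgt => Lq_le0.
rewrite (Lp_pow_eq0 p_neq0 q_neq0 mu)//.
by apply/eqP; rewrite eq_le Lq_le0 Lp_pow_ge0.
Qed.

Lemma Cc_infty_in_Wsp (s p : R) (u : 'rV[R]_d -> R) :
  0 < p -> measurable_Rd u -> Cc_infty u -> in_Wsp s p u.
Proof.
move=> p_gt0 mu u_Cc; split=> //; exists (fun=> u); split=> [//|w].
suff w0 n : (Lp_pow p (w n) + gagliardo_pow s p (w n) = 0)%E.
  by under eq_fun do rewrite w0; exact: cvg_cst.
have pow0 : `|0 : R| `^ p = 0 by rewrite normr0 powR0// gt_eqF.
have -> : w n = cst 0 by apply: funext => x; rewrite /w subrr.
rewrite /Lp_pow /gagliardo_pow /=.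
under eq_fun do rewrite pow0.
under [in X in (_ + X)%E]eq_fun => y.
  under eq_fun do rewrite subrr pow0 mul0r.
  over.
by rewrite !intRd_cst0 adde0.
Qed.

Variables p s q : R.
Hypotheses (s_gt0 : 0 < s) (s_lt1 : s < 1) (p_gt0 : 0 < p) (q_gt0 : 0 < q).

Lemma Lp_pow_bumpRd_lty (e : R) : 0 < e -> (Lp_pow e (@bumpRd R d) < +oo)%E.
Proof.
move=> e_gt0; apply: (@Lp_pow_lty _ _ _ _ 1 1) => // x; last exact: bumpRd_eq0.
by rewrite ger0_norm ?bumpRd_ge0 ?bumpRd_le1.
Qed.

Lemma Lp_pow_bumpRd_gt0 (e : R) : 0 < e -> (0 < Lp_pow e (@bumpRd R d))%E.
Proof.
move=> e_gt0; apply: (@Lp_pow_gt0 _ _ _ _ (expR (- 2) ^+ d) 2^-1) => //.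
exact: bumpRd_ge.
Qed.

Lemma gagliardo_pow_bumpRd_lty : (gagliardo_pow s p (@bumpRd R d) < +oo)%E.
Proof.
apply: (@gagliardo_pow_lty _ _ _ _ s_gt0 s_lt1 p_gt0 _ (4 * d%:R) 1 1) => //.
- exact: bumpRd_lipschitz.
- by move=> x; rewrite ger0_norm ?bumpRd_ge0 ?bumpRd_le1.
- exact: bumpRd_eq0.
Qed.

Lemma bumpRd_in_Dpqs : in_Dpqs s p q (@bumpRd R d).
Proof.
split; last split.
- exact: Cc_infty_in_Wsp p_gt0 (@measurable_bumpRd R d) (@Cc_infty_bumpRd R d).
- by split; [exact: measurable_bumpRd|exact: Lp_pow_bumpRd_lty].
- exact: Lp_pow_bumpRd_gt0.
Qed.
End AdmissibleFunctions.

Section Exponents.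
Variables (R : realType) (d : nat) (p s q : R).
Hypotheses (p_gt1 : 1 < p) (pq : p < q).

Let p1_gt0 : 0 < p - 1. Proof. by rewrite subr_gt0. Qed.
Let q1_gt0 : 0 < q - 1. Proof. by rewrite subr_gt0 (lt_trans p_gt1). Qed.

Lemma target_exponent_gt : q < p * (q - 1) / (p - 1).
Proof. by rewrite ltr_pdivlMr//; move: pq; lra. Qed.

Lemma target_exponent_subcritical : s * p < d%:R ->
  q < p * (d%:R - s) / (d%:R - s * p) ->
  0 < sobolev_gap d p s (p * (q - 1) / (p - 1)).
Proof.
move=> sp_lt_d; rewrite ltr_pdivlMr ?subr_gt0// => q_lt.
rewrite /sobolev_gap mulrA ltr_pdivrMr// -subr_gt0.
rewrite (_ : _ - _ = p * (p * (d%:R - s) - q * (d%:R - s * p))); last by ring.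
by rewrite mulr_gt0 ?subr_gt0// (lt_trans _ p_gt1).
Qed.

Lemma target_exponent_weight (r := p * (q - 1) / (p - 1)) :
  sobolev_gap d p s q != 0 ->
  p * d%:R * (r - q) / (r * sobolev_gap d p s q) =
  d%:R * (q - p) / ((q - 1) * sobolev_gap d p s q).
Proof.
have p_neq0 : p != 0 by rewrite gt_eqF// (lt_trans _ p_gt1).
rewrite /r /sobolev_gap => gap_neq0; field.
by rewrite gap_neq0 p_neq0 !gt_eqF.
Qed.
End Exponents.

Lemma gagliardo_nirenberg_admissible (R : realType) (d : nat) (p s q : R)
    (r := p * (q - 1) / (p - 1))
    (a := d%:R * (q - p) / ((q - 1) * sobolev_gap d p s q)) :
  (0 < d)%N -> 1 < p -> 0 < s -> s * p < d%:R -> p < q ->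
  q < p * (d%:R - s) / (d%:R - s * p) ->
  admissible_constants (@in_Dpqs R d s p q) (Lp_norm r)
    (gagliardo_nirenberg_rhs s p q a) !=set0.
Proof.
move=> d_gt0 p_gt1 s_gt0 sp_lt_d pq q_lt.
have p_gt0 : 0 < p by exact: lt_trans p_gt1.
have q_gt0 : 0 < q by exact: lt_trans pq.
have qr : q < r := target_exponent_gt p_gt1 pq.
have r_subcritical : 0 < sobolev_gap d p s r by exact: target_exponent_subcritical.
have gap_gt0 : 0 < sobolev_gap d p s q.
  by apply: lt_trans r_subcritical _; rewrite ltr_sobolev_gap.
have [C _] :=
  gagliardo_nirenberg d_gt0 p_gt0 s_gt0 sp_lt_d q_gt0 gap_gt0 qr r_subcritical.
rewrite target_exponent_weight ?gt_eqF// => GN.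
exists C => u Du; apply: GN Du.2.1.1 _ Du.2.1.2.
by apply: in_Dpqs_Lp_pow_gt0 Du; rewrite gt_eqF.
Qed.

Theorem theorem1p4 (R : realType) (d : nat) (p s q : R) :
  (1 <= d)%N -> 1 < p -> 0 < s -> s < 1 -> s * p < d%:R ->
  p < q -> q < p * (d%:R - s) / (d%:R - s * p) ->
  let r := p * (q - 1) / (p - 1) in
  let a := d%:R * (q - p) /
           ((q - 1) * (d%:R * p - (d%:R - s * p) * q)) in
  exists L : R, 0 < L /\
    (forall u : 'rV[R]_d -> R, in_Dpqs s p q u ->
       (Lp_norm r u <=
        L%:E * poweR (gagliardo s p u) a * poweR (Lp_norm q u) (1 - a))%E) /\
    (forall L' : R,
       (forall u : 'rV[R]_d -> R, in_Dpqs s p q u ->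
          (Lp_norm r u <=
           L'%:E * poweR (gagliardo s p u) a * poweR (Lp_norm q u) (1 - a))%E) ->
       L <= L').
Proof.
move=> d_gt0 p_gt1 s_gt0 s_lt1 sp_lt_d pq q_lt r a.
have p_gt0 : 0 < p by exact: lt_trans p_gt1.
have q_gt0 : 0 < q by exact: lt_trans pq.
have r_gt0 : 0 < r by exact: lt_trans (target_exponent_gt p_gt1 pq).
pose K := @gagliardo_nirenberg_rhs R d s p q a.
have K_ge0 : forall u, (0 <= K u)%E := gagliardo_nirenberg_rhs_ge0 s p q a.
have norm_ge0 (u : 'rV[R]_d -> R) : (0 <= Lp_norm r u)%E by exact: poweR_ge0.
have admissible_neq0 : admissible_constants (in_Dpqs s p q) (Lp_norm r) K !=set0.
  exact: gagliardo_nirenberg_admissible.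
have K_bump_lty : (K (@bumpRd R d) < +oo)%E.
  apply: gagliardo_nirenberg_rhs_lty; first exact: gagliardo_pow_bumpRd_lty.
  exact: Lp_pow_bumpRd_lty.
have norm_bump_gt0 : (0 < Lp_norm r (@bumpRd R d))%E.
  by rewrite poweR_gt0// Lp_pow_bumpRd_gt0.
have [L [L_gt0 L_admissible L_min]] := exists_optimal_constant norm_ge0 K_ge0
  admissible_neq0 (bumpRd_in_Dpqs d s p_gt0 q_gt0) norm_bump_gt0 K_bump_lty.
exists L; split=> //; split=> [u Du|L' L'_admissible].
  by rewrite -muleA; exact: L_admissible.
by apply: L_min => u Du; rewrite muleA; exact: L'_admissible.
Qed.
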